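(* Let $\mathfrak g$ be a complex simple Lie algebra, $\boldsymbol\Lambda=(\Lambda_1,\dots,\Lambda_n)$ a collection of weights $\Lambda_i\in\mathfrak h^*$, $\boldsymbol k=(k_1,\dots,k_r)$ a collection of non-negative integers, $k=k_1+\dots+k_r$, and $z=(z_1,\dots,z_n)$ a collection of distinct complex numbers. Let $\Phi(\cdot,z,\boldsymbol\Lambda,\boldsymbol k)$ be the master function, $\omega(z,t)$ the canonical weight function, and $S_{V_{\boldsymbol\Lambda}}$ the tensor product Shapovalov form on $V_{\boldsymbol\Lambda}=V_{\Lambda_1}\otimes\dots\otimes V_{\Lambda_n}$. Let $t^1,t^2\in\mathbb C^k$ be points such that $t^1$ has distinct coordinates, $t^2$ has distinct coordinates, and none of the coordinates of $t^1,t^2$ belongs to $\{z_1,\dots,z_n\}$. Then: (i) Assume that $t^1$ and $t^2$ are isolated critical points of $\Phi(\cdot,z,\boldsymbol\Lambda,\boldsymbol k)$ and that the $\boldsymbol\Sigma_{\boldsymbol k}$-orbits of $t^1$ and $t^2$ do not intersect. Then the Bethe vectors $\omega(z,t^1)$ and $\omega(z,t^2)$ are orthogonal: $S_{V_{\boldsymbol\Lambda}}(\omega(z,t^1),\omega(z,t^2))=0$. (ii) Assume that $t^1$ is an isolated critical point of $\Phi(\cdot,z,\boldsymbol\Lambda,\boldsymbol k)$. Then $$S_{V_{\boldsymbol\Lambda}}(\omega(z,t^1),\omega(z,t^1))=\det_{1\le i,j\le k}\Big(\frac{\partial^2}{\partial t_i\partial t_j}\ln\Phi(t^1,z,\boldsymbol\Lambda,\boldsymbol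 k)\Big).$$ (iii) Let $d$ be a natural number and let $C$ be a set of $d$ distinct $\boldsymbol\Sigma_{\boldsymbol k}$-orbits of non-degenerate critical points of $\Phi(\cdot,z,\boldsymbol\Lambda,\boldsymbol k)$. Choose a representative $t^i$ in each orbit. Assume that each point $t^i$ has distinct coordinates and none of the coordinates of $t^i$ belongs to $\{z_1,\dots,z_n\}$. Then the Bethe vectors $\omega(z,t^i)$, $i=1,\dots,d$, span a $d$-dimensional subspace in $\mathrm{Sing}\,V_{\boldsymbol\Lambda}[\Lambda-\alpha(\boldsymbol k)]$.
   Context: Lie algebra: $\mathfrak g$ is a simple Lie algebra over $\mathbb C$ with Cartan matrix $(a_{i,j})_{i,j=1}^r$, Cartan subalgebra $\mathfrak h$, simple roots $\alpha_1,\dots,\alpha_r\in\mathfrak h^*$, and a fixed invariant bilinear form $(\,,)$ on $\mathfrak g$ (also inducing a form on $\mathfrak h^*$). $H_1,\dots,H_r\in\mathfrak h$ are the coroots, $\langle\lambda,H_i\rangle=2(\lambda,\alpha_i)/(\alpha_i,\alpha_i)$. Chevalley generators $E_i\in\mathfrak n_+$, $H_i\in\mathfrak h$, $F_i\in\mathfrak n_-$ satisfy $[E_i,F_j]=\delta_{i,j}H_i$, $[h,E_i]=\langle\alpha_i,h\rangle E_i$, $[h,F_i]=-\langle\alpha_i,h\rangle F_i$, $[h,h']=0$ for $h,h'\in\mathfrak h$, and the Serre relations. Modules: $V_\mu$ is the irreducible $\mathfrak g$-module with highest weight $\mu\in\mathfrak h^*$. For a $\mathfrak g$-module $V$, $V[\mu]$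 is the weight subspace of weight $\mu$ and $\mathrm{Sing}\,V[\mu]=\{x\in V:\mathfrak n_+x=0,\ hx=\langle\mu,h\rangle x\ \forall h\in\mathfrak h\}$. Fix a highest weight vector $v_{\Lambda_i}\in V_{\Lambda_i}$ for each $i$. Set $\Lambda=\Lambda_1+\dots+\Lambda_n$, $\alpha(\boldsymbol k)=k_1\alpha_1+\dots+k_r\alpha_r$. Shapovalov form: let $\tau:\mathfrak g\to\mathfrak g$ be the anti-involution with $\tau(E_i)=F_i$, $\tau(H_i)=H_i$, $\tau(F_i)=E_i$. On a highest weight module with highest weight vector $w$, the Shapovalov form is the unique symmetric bilinear form $S$ with $S(w,w)=1$ and $S(xu,u')=S(u,\tau(x)u')$ for $x\in\mathfrak g$. With $S_i$ the Shapovalov form of $V_{\Lambda_i}$ (relative to $v_{\Lambda_i}$), the tensor product Shapovalov form is $S_{V_{\boldsymbol\Lambda}}=S_1\otimes\dots\otimes S_n$. Master function: let $c:\{1,\dots,k\}\to\{1,\dots,r\}$ be the unique non-decreasing function with $\#c^{-1}(i)=k_i$ for all $i$. Then $$\Phi(t,z,\boldsymbol\Lambda,\boldsymbol k)=\prod_{1\le i<j\le n}(z_i-z_j)^{(\Lambda_i,\Lambda_j)}\prod_{i=1}^k\prod_{s=1}^n(t_i-z_s)^{-(\alpha_{c(i)},\Lambda_s)}\prod_{1\le i<j\le k}(t_i-t_j)^{(\alpha_{c(i)},\alpha_{c(j)})},$$ viewed as a function of $t=(t_1,\dots,t_k)$. A point $t$ is critical if $-\sum_{s=1}^n\frac{(\alpha_{c(i)},\Lambda_s)}{t_i-z_s}+\sum_{j\ne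 i}\frac{(\alpha_{c(i)},\alpha_{c(j)})}{t_i-t_j}=0$ for $i=1,\dots,k$. It is non-degenerate if $\det(\partial^2\ln\Phi/\partial t_i\partial t_j)\neq0$ there. Symmetry group: $\boldsymbol\Sigma_{\boldsymbol k}\cong\Sigma_{k_1}\times\dots\times\Sigma_{k_r}$ is the group of permutations of $\{1,\dots,k\}$ preserving the level sets of $c$; it acts on $\mathbb C^k$ by permuting coordinates and preserves the critical set. Canonical weight function: $P(\boldsymbol k,n)$ is the set of sequences $I=(i^1_1,\dots,i^1_{j_1};\dots;i^n_1,\dots,i^n_{j_n})$ of integers in $\{1,\dots,r\}$ (the lengths $j_1,\dots,j_n\ge0$ may vary) such that each $i\in\{1,\dots,r\}$ appears in $I$ exactly $k_i$ times. For $\sigma\in\Sigma_k$ (the permutation group of $\{1,\dots,k\}$) set $\sigma_1(i)=\sigma(i)$ for $1\le i\le j_1$ and $\sigma_s(i)=\sigma(j_1+\dots+j_{s-1}+i)$ for $s\ge2$, $1\le i\le j_s$. Let $\Sigma(I)=\{\sigma\in\Sigma_k: c(\sigma_s(j))=i^s_j\text{ for } s=1,\dots,n,\ j=1,\dots,j_s\}$. Put $$F_Iv=F_{i^1_1}\cdots F_{i^1_{j_1}}v_{\Lambda_1}\otimes\dots\otimes F_{i^n_1}\cdots F_{i^n_{j_n}}v_{\Lambda_n},$$ $$\omega_{i_1,\dots,i_j}(z_s)=\frac1{(t_{i_1}-t_{i_2})\cdots(t_{i_{j-1}}-t_{i_j})(t_{i_j}-z_s)}$$ (equal to $1$ for an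 empty index sequence), and $\omega_{I,\sigma}=\omega_{\sigma_1(1),\dots,\sigma_1(j_1)}(z_1)\cdots\omega_{\sigma_n(1),\dots,\sigma_n(j_n)}(z_n)$. Then $$\omega(z,t)=\sum_{I\in P(\boldsymbol k,n)}\sum_{\sigma\in\Sigma(I)}\omega_{I,\sigma}\,F_Iv\ \in V_{\boldsymbol\Lambda}[\Lambda-\alpha(\boldsymbol k)].$$ A Bethe vector is the value of $\omega(z,\cdot)$ at a critical point of $\Phi(\cdot,z,\boldsymbol\Lambda,\boldsymbol k)$.
   Formalization: In (ii) the left side S(ω(z,t^1),ω(z,t^1)) is multiplied by ∏_i((α_i,α_i)/2)^{k_i}: with Chevalley generators and an arbitrary invariant form the literal equation fails (sl_2, two fundamental modules, k=1, (α,α)≠2); it is unchanged when this factor is 1. *)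

(* Defs.v *)
From HB Require Import structures.
From mathcomp Require Import all_boot all_order all_algebra all_fingroup.
From mathcomp Require Import sesquilinear.
From mathcomp Require Import all_classical all_reals all_analysis.
From mathcomp Require Import complex.
Set Implicit Arguments.
Unset Strict Implicit.
Unset Printing Implicit Defensive.
Import Order.TTheory GRing.Theory Num.Theory.
Import numFieldNormedType.Exports.
Local Open Scope classical_set_scope.
Local Open Scope ring_scope.

Record lie_algebra (K : fieldType) := LieAlgebra {
  lie_sort :> vectType K;
  bracket : {bilinear lie_sort -> lie_sort -> lie_sort};
  bracket_alt : forall x, bracket x x = 0;
  bracket_jacobi : forall x y z,
    bracket x (bracket y z) + bracket y (bracket z x)
      + bracket z (bracket x y) = 0 }.

Arguments bracket {K g} : rename.

Section LieAlgebra.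
Variables (K : fieldType) (g : lie_algebra K).
Local Notation "[[ x , y ]]" := (bracket (g := g) x y) (at level 0).

Definition subalgebra (U : {vspace g}) : Prop :=
  forall x y, x \in U -> y \in U -> [[x, y]] \in U.

Definition ideal (U : {vspace g}) : Prop :=
  forall x y, y \in U -> [[x, y]] \in U.

Definition simple_lie : Prop :=
  (exists x y, [[x, y]] != 0) /\
  (forall U, ideal U -> U = 0%VS \/ U = fullv).

Definition nilpotent_subalgebra (U : {vspace g}) : Prop :=
  subalgebra U /\
  exists N, forall xs : N.-tuple g, {subset xs <= U} ->
    forall y, y \in U -> foldr (fun x w => [[x, w]]) y xs = 0.

Definition cartan_subalgebra (U : {vspace g}) : Prop :=
  nilpotent_subalgebra U /\
  (forall x, (forall y, y \in U -> [[x, y]] \in U) -> x \in U).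

Section Roots.
Variable h : {vspace g}.

(* The dual space h^*, with pairing <mu, x> written mu x. *)
Definition weight := 'Hom(subvs_of h, K^o).

Definition root_space (beta : weight) (x : g) : Prop :=
  forall y : subvs_of h, [[vsval y, x]] = beta y *: x.

Definition is_root (beta : weight) : Prop :=
  beta != 0 /\ exists x, x != 0 /\ root_space beta x.

Definition nat_combination (r : nat) (alpha : 'I_r -> weight)
    (beta : weight) : Prop :=
  exists m : 'I_r -> nat, beta = \sum_i alpha i *+ m i.

Definition simple_roots (r : nat) (alpha : 'I_r -> weight) : Prop :=
  [/\ forall i, is_root (alpha i),
      free [tuple alpha i | i < r]
    & forall beta, is_root beta ->
        nat_combination alpha beta \/ nat_combination alpha (- beta)].

End Roots.
End LieAlgebra.

(* A simple Lie algebra with the choices fixed throughout: Cartan subalgebra,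
   simple roots, non-degenerate invariant form and Chevalley generators.  The
   Cartan matrix is normalized by a_(i,j) = <alpha_j, H_i>.  The vector [hsharp
   mu] is the element of h that represents mu through the invariant form. *)
Record simple_lie_algebra (K : fieldType) (r : nat) := SimpleLieAlgebra {
  sla :> lie_algebra K;
  sla_simple : simple_lie sla;
  sla_form : {bilinear sla -> sla -> K | *%R & *%R};
  sla_form_sym : forall x y, sla_form x y = sla_form y x;
  sla_form_inv : forall x y z,
    sla_form (bracket x y) z = sla_form x (bracket y z);
  sla_form_nondeg : forall x, (forall y, sla_form x y = 0) -> x = 0;
  sla_h : {vspace sla};
  sla_h_cartan : cartan_subalgebra sla_h;
  sla_hC : forall x y : subvs_of sla_h, bracket (vsval x) (vsval y) = 0;
  hsharp : weight sla_h -> subvs_of sla_h;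
  hsharpP : forall (mu : weight sla_h) (x : subvs_of sla_h),
    sla_form (vsval (hsharp mu)) (vsval x) = mu x;
  sroot : 'I_r -> weight sla_h;
  sroot_simple : simple_roots sroot;
  cartan_mx : 'M[int]_r;
  gE : 'I_r -> sla;
  gF : 'I_r -> sla;
  gH : 'I_r -> subvs_of sla_h;
  gH_coroot : forall (mu : weight sla_h) i,
    mu (gH i) = 2 * mu (hsharp (sroot i)) / sroot i (hsharp (sroot i));
  cartan_mxE : forall i j, (cartan_mx i j)%:~R = sroot j (gH i);
  gEF : forall i j, bracket (gE i) (gF j) = if i == j then vsval (gH i) else 0;
  ghE : forall (x : subvs_of sla_h) i,
    bracket (vsval x) (gE i) = sroot i x *: gE i;
  ghF : forall (x : subvs_of sla_h) i,
    bracket (vsval x) (gF i) = - sroot i x *: gF i;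
  serreE : forall i j, i != j ->
    iter `|1 - cartan_mx i j|%N (bracket (gE i)) (gE j) = 0;
  serreF : forall i j, i != j ->
    iter `|1 - cartan_mx i j|%N (bracket (gF i)) (gF j) = 0;
  chevalley_gen : forall U : {vspace sla}, subalgebra U ->
    (forall i, [/\ gE i \in U, gF i \in U & vsval (gH i) \in U]) ->
    U = fullv }.

Section Weights.
Variables (K : fieldType) (r : nat) (g : simple_lie_algebra K r).

Definition hweight := weight (sla_h g).

Definition wform (lam mu : hweight) : K := lam (hsharp mu).

Definition positive_root (beta : hweight) : Prop :=
  is_root beta /\ nat_combination (@sroot K r g) beta.

(* prod_i ((alpha_i, alpha_i) / 2)^(kk i).  The master function depends on the
   choice of the invariant form, the Chevalley generators do not: [E_i, F_i] is
   the coroot H_i, while the element of h representing alpha_i through the form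
   is ((alpha_i, alpha_i) / 2) H_i.  This is the resulting ratio between the
   Hessian of ln Phi and the Shapovalov norm of a Bethe vector; it is 1 when
   (alpha_i, alpha_i) = 2 for all i. *)
Definition form_normalization (kk : 'I_r -> nat) : K :=
  \prod_i (wform (sroot g i) (sroot g i) / 2) ^+ kk i.

(* The sum of the root spaces of the positive roots. *)
Definition n_plus : set g :=
  [set x | forall U : {vspace g},
     (forall beta, positive_root beta ->
        forall y, root_space beta y -> y \in U) -> x \in U].

Definition chevalley_anti_involution (tau : {linear g -> g}) : Prop :=
  [/\ forall x y, tau (bracket x y) = bracket (tau y) (tau x),
      forall x, tau (tau x) = x
    & forall i, [/\ tau (gE g i) = gF g i, tau (gF g i) = gE g i
                  & tau (vsval (gH g i)) = vsval (gH g i)]].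

End Weights.

Record lie_module (K : fieldType) (g : lie_algebra K) := LieModule {
  lm_sort :> lmodType K;
  act : {bilinear g -> lm_sort -> lm_sort};
  act_bracket : forall x y v,
    act (bracket x y) v = act x (act y v) - act y (act x v) }.

Arguments act {K g V} : rename.

Section Modules.
Variables (K : fieldType) (r : nat) (g : simple_lie_algebra K r).

Definition sing (V : lie_module g) (mu : hweight g) : set V :=
  [set v | (forall x, n_plus x -> act x v = 0) /\
           (forall y : subvs_of (sla_h g), act (vsval y) v = mu y *: v)].

Definition submodule (V : lie_module g) (U : set V) : Prop :=
  [/\ U 0, forall (a : K) u v, U u -> U v -> U (a *: u + v)
    & forall x u, U u -> U (act x u)].

Definition irreducible_module (V : lie_module g) : Prop :=
  (exists v : V, v != 0) /\
  (forall U : set V, submodule U -> U = [set 0] \/ U = setT).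

(* A model of V_mu, with its fixed highest weight vector. *)
Record hw_irrep (mu : hweight g) := HwIrrep {
  hw_mod :> lie_module g;
  hw_irr : irreducible_module hw_mod;
  hwv : hw_mod;
  hwv_neq0 : hwv != 0;
  hwv_sing : sing mu hwv }.

Definition shapovalov_form (tau : {linear g -> g}) (mu : hweight g)
    (V : hw_irrep mu) (S : {bilinear V -> V -> K | *%R & *%R}) : Prop :=
  [/\ forall u v, S u v = S v u, S (hwv V) (hwv V) = 1
    & forall x u v, S (act x u) v = S u (act (tau x) v)].

End Modules.

Definition multilinear (K : fieldType) (n : nat) (V : 'I_n -> lmodType K)
    (W : lmodType K) (f : (forall s, V s) -> W) : Prop :=
  forall (v : forall s, V s) (s : 'I_n) (a : K) (x y : V s),
    f (dfwith v s (a *: x + y)) = a *: f (dfwith v s x) + f (dfwith v s y).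

(* The tensor product of the V_s, given by its universal property, with the
   g-action x (v_1 (x) ... (x) v_n) = sum_s v_1 (x) ... (x) x v_s (x) ... *)
Record tensor_module (K : fieldType) (g : lie_algebra K) (n : nat)
    (V : 'I_n -> lie_module g) := TensorModule {
  tm_mod :> lie_module g;
  pure : (forall s, V s) -> tm_mod;
  pure_multilinear : @multilinear K n V tm_mod pure;
  pure_universal : forall (W : lmodType K) (f : (forall s, V s) -> W),
    multilinear (V := V) f ->
    exists2 phi : {linear tm_mod -> W},
      forall v, phi (pure v) = f v
    & forall psi : {linear tm_mod -> W},
        (forall v, psi (pure v) = f v) -> psi =1 phi;
  act_pure : forall x v,
    act x (pure v) = \sum_s pure (dfwith v s (act x (v s))) }.

Definition tensor_form (K : fieldType) (g : lie_algebra K) (n : nat)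
    (V : 'I_n -> lie_module g) (T : tensor_module V)
    (SV : forall s, {bilinear V s -> V s -> K | *%R & *%R})
    (S : {bilinear T -> T -> K | *%R & *%R}) : Prop :=
  forall u v, S (pure T u) (pure T v) = \prod_s SV s (u s) (v s).

Section Span.
Variables (K : fieldType) (W : lmodType K).

Definition lin_span (d : nat) (w : 'I_d -> W) : set W :=
  [set x | exists a : 'I_d -> K, x = \sum_i a i *: w i].

Definition lin_indep (d : nat) (w : 'I_d -> W) : Prop :=
  forall a : 'I_d -> K, \sum_i a i *: w i = 0 -> forall i, a i = 0.

Definition has_dim (U : set W) (d : nat) : Prop :=
  exists e : 'I_d -> W, lin_indep e /\ lin_span e = U.

End Span.

Section Coloring.
Variables (r k : nat) (c : 'I_k -> 'I_r).

Definition coloring (kk : 'I_r -> nat) : Prop :=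
  {homo c : i j / (i <= j)%N} /\ (forall i, #|[set j | c j == i]%SET| = kk i).

Definition color_orbit (K : Type) (t : 'rV[K]_k) : set 'rV[K]_k :=
  [set col_perm s t | s in [set s : 'S_k | forall i, c (s i) = c i]].

End Coloring.

Section Master.
Variables (K : numFieldType) (r : nat) (g : simple_lie_algebra K r).
Variables (n k : nat) (Lam : 'I_n -> hweight g) (c : 'I_k -> 'I_r).
Variable z : 'I_n -> K.

Let alpha (i : 'I_k) : hweight g := sroot g (c i).

(* The partial derivative of ln Phi in t_i.  Phi and ln Phi are multivalued, but
   this function is not; it enters only near points with [off_diagonal t], where
   no denominator vanishes. *)
Definition dlog_master (i : 'I_k) (t : 'rV[K]_k) : K :=
  - (\sum_s wform (alpha i) (Lam s) / (t 0 i - z s))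
  + \sum_(j | j != i) wform (alpha i) (alpha j) / (t 0 i - t 0 j).

Definition critical (t : 'rV[K]_k) : Prop := forall i, dlog_master i t = 0.

Definition isolated_critical (t : 'rV[K]_k) : Prop :=
  isolated (critical : set 'rV[K]_k) t.

Definition hessian_log_master (t : 'rV[K]_k) : 'M[K]_k :=
  \matrix_(i, j) 'D_(delta_mx 0 j) (dlog_master i) t.

Definition nondegenerate_critical (t : 'rV[K]_k) : Prop :=
  critical t /\ \det (hessian_log_master t) != 0.

Definition off_diagonal (t : 'rV[K]_k) : Prop :=
  injective (t 0) /\ (forall i s, t 0 i != z s).

End Master.

Section WeightFunction.
Variables (K : fieldType) (r : nat) (g : simple_lie_algebra K r).
Variables (n k : nat).

(* A sequence in P(kk, n), as the family of its n blocks; the bound k on the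
   length of each block loses nothing when k is the sum of the kk i. *)
Definition words := {ffun 'I_n -> k.-bseq 'I_r}.

Definition in_P (kk : 'I_r -> nat) (I : words) : bool :=
  [forall i, \sum_s count_mem i (I s) == kk i]%N.

(* The sequence sigma_s(1), ..., sigma_s(j_s). *)
Definition perm_block (I : words) (sigma : 'S_k) (s : 'I_n) : seq 'I_k :=
  take (size (I s))
    (drop (\sum_(s' < n | (s' < s)%N) size (I s')) [seq sigma i | i : 'I_k]).

Definition in_Sigma (c : 'I_k -> 'I_r) (I : words) (sigma : 'S_k) : bool :=
  [forall s, map c (perm_block I sigma s) == I s :> seq 'I_r].

Fixpoint omega_chain (t : 'rV[K]_k) (zs : K) (js : seq 'I_k) : K :=
  if js is j :: js' then
    (t 0 j - (if js' is j' :: _ then t 0 j' else zs))^-1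
      * omega_chain t zs js'
  else 1.

Definition omega_coef (z : 'I_n -> K) (t : 'rV[K]_k) (I : words)
    (sigma : 'S_k) : K :=
  \prod_s omega_chain t (z s) (perm_block I sigma s).

Variables (Lam : 'I_n -> hweight g) (V : forall s, hw_irrep (Lam s)).

Definition F_word (I : words) (s : 'I_n) : V s :=
  foldr (fun i v => act (gF g i) v) (hwv (V s)) (I s).

Definition weight_function (T : tensor_module V) (kk : 'I_r -> nat)
    (c : 'I_k -> 'I_r) (z : 'I_n -> K) (t : 'rV[K]_k) : T :=
  \sum_(I : words | in_P kk I) \sum_(sigma : 'S_k | in_Sigma c I sigma)
    omega_coef z t I sigma *: pure T (F_word I).

End WeightFunction.

(* Main.v *)
Require Import Defs.
From mathcomp Require Import all_boot all_order all_algebra all_fingroup.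
From mathcomp Require Import sesquilinear.
From mathcomp Require Import all_classical all_reals all_analysis.
From mathcomp Require Import complex.
From mathcomp Require Import ring.
Set Implicit Arguments.
Unset Strict Implicit.
Unset Printing Implicit Defensive.
Import Order.TTheory GRing.Theory Num.Theory.
Import numFieldNormedType.Exports.
Local Open Scope classical_set_scope.
Local Open Scope complex_scope.
Local Open Scope ring_scope.

(** The whole theorem comes from one identity, valid for any two points [t], [u]
    off the diagonals ([form_weight_functions]): up to the normalization of the
    form,
      S (omega t) (omega u) = sum over sigma of det M(t, sigma u),
    where sigma runs over the permutations that preserve the colors and
    M(t, u) ([gram_mx]) is the Hessian of ln Phi in which every square
    (x - y)^2 of a difference at one point is replaced by the product of the
    corresponding differences at [t] and at [u].

    On the one hand M(t, t) is the Hessian ([hessian_gram_mx]).  On the other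
    hand 1/(u_i - u_j) - 1/(t_i - t_j) has numerator
    (t_i - t_j) - (u_i - u_j), so that M(t, u) maps the vector t - u to the
    difference of the gradients of ln Phi at [t] and [u] ([gram_mx_sub]).  At two
    critical points this difference is zero, hence det M(t, u) = 0 unless t = u.
    If [t] and [u] are critical points in different orbits, all the terms of the
    sum vanish; if u = t, only the term of the identity survives, and it is the
    determinant of the Hessian.  Bethe vectors of non-degenerate points are
    therefore pairwise orthogonal with nonzero norms, hence independent.

    The identity is proved as follows.  The labels 1, ..., k are distributed in n
    words, one for each tensor factor; omega is the sum over these arrangements W
    of the product of the chains of W times the tensor F_W v
    ([weight_function_arrs]).  In S(F_W v, omega u) the letters of W are moved one
    by one to the right, where they act as raising operators and remove letters.
    Removing a letter from all the words that contain it produces a sum over the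
    places where it can be inserted, and this sum telescopes ([sum_insert]), so
    that S(F_W v, omega u) becomes a sum of products of factors
      (Lambda, alpha)/(u_b - z) - sum (alpha, alpha)/(u_b - u_x),
    one for each letter b, with x running over the letters after b, and one
    product for each sigma ([pairing]).  There remains to sum over W the product
    of the chains at [t] and of these factors: this is a determinant
    ([forest_expansion]).  Both sides are linear in the data attached to each
    label, so each label may be assumed to have a single parent, a label or a
    site.  A label which is nobody's parent can be removed from both sides, again
    by telescoping; if every label is a parent then the parents form cycles, and
    both sides vanish.

    The same telescoping shows that E_i omega is a combination of vectors with
    the components of the gradient of ln Phi as coefficients
    ([weight_function_raise]), so Bethe vectors are killed by the E_i, hence by
    the positive root spaces, which lie in the subalgebra generated by the E_i
    because of the triangular decomposition ([triangular], [n_plus_act]). *)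

(** * Arrangements of labels into words *)

Section Arrangements.
Variables (n : nat) (T : eqType).
Implicit Types (W : {ffun 'I_n -> seq T}) (L : seq T) (b : T).

Definition insert_at s p b W : {ffun 'I_n -> seq T} :=
  [ffun s' => if s' == s then take p (W s) ++ b :: drop p (W s) else W s'].

Definition slots W : seq ('I_n * nat) :=
  [seq (s, p) | s <- enum 'I_n, p <- iota 0 (size (W s)).+1].

(** Generated by insertion, because the sums over the places of one label are
    those that telescope. *)
Fixpoint arrangements L : seq {ffun 'I_n -> seq T} :=
  if L is b :: L' then
    [seq insert_at sp.1 sp.2 b W | W <- arrangements L', sp <- slots W]
  else [:: [ffun=> [::]]].

Lemma mem_slots W s p : ((s, p) \in slots W) = (p <= size (W s))%N.
Proof.
apply/allpairsPdep/idP => [[s' [q [_]]]|ps].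
  by rewrite mem_iota add0n => /andP[_ qs] [-> ->].
by exists s, p; rewrite mem_enum mem_iota.
Qed.

Lemma count_ins (P : pred T) s p b W :
  (\sum_s' count P (insert_at s p b W s') = P b + \sum_s' count P (W s'))%N.
Proof.
rewrite (bigD1 s) //= [in RHS](bigD1 s) //= ffunE eqxx count_cat /=.
rewrite -[in RHS](cat_take_drop p (W s)) count_cat -!addnA addnCA.
by do 3?congr addn; apply: eq_bigr => s' /negPf ne; rewrite ffunE ne.
Qed.

Definition delete b W : {ffun 'I_n -> seq T} := [ffun s => rem b (W s)].

Lemma rem_insert b (w : seq T) p :
  b \notin w -> rem b (take p w ++ b :: drop p w) = w.
Proof.
move=> bw; have bt : b \notin take p w by apply: contra bw => /mem_take.
rewrite remE index_cat (negPf bt) /= eqxx addn0 take_size_cat // -cat_rcons.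
by rewrite drop_size_cat ?size_rcons // cat_take_drop.
Qed.

Lemma index_insert b (w : seq T) p :
  b \notin w -> (p <= size w)%N -> index b (take p w ++ b :: drop p w) = p.
Proof.
move=> bw pw; have bt : b \notin take p w by apply: contra bw => /mem_take.
by rewrite index_cat (negPf bt) /= eqxx addn0 size_takel.
Qed.

Lemma insert_rem b (w : seq T) :
  b \in w -> take (index b w) (rem b w) ++ b :: drop (index b w) (rem b w) = w.
Proof.
move=> bw; have iw : (index b w < size w)%N by rewrite index_mem.
rewrite remE take_size_cat ?size_takel 1?ltnW //.
rewrite drop_size_cat ?size_takel 1?ltnW //.
by rewrite -[RHS](cat_take_drop (index b w) w) (drop_nth b iw) nth_index.
Qed.

Lemma mem_insert b (w : seq T) p :
  take p w ++ b :: drop p w =i b :: w.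
Proof.
move=> x; rewrite mem_cat !inE -[in RHS](cat_take_drop p w) mem_cat.
by rewrite orbCA.
Qed.

(** The counting characterization forgets the order of [L], which makes sums over
    arrangements invariant under permutations of [L] ([sum_arrs_perm]). *)
Lemma arrsP L W :
  reflect (forall P : pred T, (\sum_s count P (W s))%N = count P L)
          (W \in arrangements L).
Proof.
apply: (iffP idP); elim: L W => [|b L IH] W.
- by rewrite inE => /eqP-> P; rewrite big1 // => s _; rewrite ffunE.
- by case/allpairsPdep=> W' [sp [W'L _ ->]] P; rewrite count_ins (IH W').
- move=> cW; rewrite inE; apply/eqP/ffunP => s; rewrite ffunE.
  have /eqP := cW predT; rewrite sum_nat_eq0 => /forallP/(_ s)/=.
  by rewrite count_predT => /nilP.
move=> cW; have [s bs] : exists s, b \in W s.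
  apply/existsP; apply: contraT => /existsPn nb.
  have := cW (pred1 b); rewrite big1 /= ?eqxx // => s _.
  by apply/count_memPn/nb.
set W' := [ffun s' => if s' == s then rem b (W s) else W s'].
have WE : W = insert_at s (index b (W s)) b W'.
  apply/ffunP => s'; rewrite !ffunE eqxx; case: eqP => [->|//].
  by rewrite insert_rem.
apply/allpairsPdep; exists W', (s, index b (W s)); split=> //.
  apply: IH => P; move/(_ P): cW; rewrite {1}WE count_ins /= => /eqP.
  by rewrite eqn_add2l => /eqP.
rewrite mem_slots ffunE eqxx size_rem //; move: bs; rewrite -index_mem.
by case: (size _).
Qed.

Lemma arrs_mem L W x : W \in arrangements L -> (x \in L) = [exists s, x \in W s].
Proof.
move=> /arrsP/(_ (pred1 x)) cW; rewrite -has_pred1 has_count -cW lt0n sum_nat_eq0.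
rewrite negb_forall; apply: eq_existsb => s.
by rewrite -lt0n -has_count has_pred1.
Qed.

Lemma arrs_sub L W s x : W \in arrangements L -> x \in W s -> x \in L.
Proof. by move=> WL xs; rewrite (arrs_mem _ WL); apply/existsP; exists s. Qed.

Lemma arrs_uniq L W s : uniq L -> W \in arrangements L -> uniq (W s).
Proof.
move=> uL WL; apply: count_mem_uniq => x; have cL := count_uniq_mem _ uL.
have := arrsP _ _ WL (pred1 x); rewrite cL (bigD1 s) //=.
have := arrs_sub WL (s := s) (x := x); case: (boolP (x \in W s)) => xs.
  move=> /(_ isT)-> /=; move: xs; rewrite -has_pred1 has_count.
  by case: (count _ _) => // -[] //.
by move=> _ _; apply/count_memPn.
Qed.

Lemma arrs_disjoint L W s s' x :
  uniq L -> W \in arrangements L -> x \in W s -> x \in W s' -> s = s'.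
Proof.
move=> uL WL xs xs'; have cL := count_uniq_mem _ uL; apply/eqP; apply: contraT => ne.
have := arrsP _ _ WL (pred1 x); rewrite cL (arrs_sub WL xs).
rewrite (bigD1 s) // (bigD1 s') 1?eq_sym //=.
move: xs xs'; rewrite -!has_pred1 !has_count.
by case: count => // u; case: count => // v; rewrite addnS.
Qed.

Lemma uniq_arrs L : uniq L -> uniq (arrangements L).
Proof.
elim: L => // b L IH /= /andP[bL uL].
have nb W s : W \in arrangements L -> b \notin W s.
  by move=> WL; apply: contra bL; apply: arrs_sub.
apply: allpairs_uniq_dep; first exact: IH.
  move=> W _; apply: allpairs_uniq_dep => [|s _|]; rewrite ?enum_uniq //.
    exact: iota_uniq.
  by move=> [s p] [s' p'] _ _ /= [-> ->].
move=> x y /allpairsPdep[W [[s p] [WL sW ->]]].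
move=> /allpairsPdep[W' [[s' p'] [WL' sW' ->]]] /=.
rewrite !mem_slots in sW sW' => eqW.
have ss' : s = s'.
  have /ffunP/(_ s) := eqW; rewrite !ffunE eqxx; case: eqP => // _ e.
  by have := nb W' s WL'; rewrite -e mem_insert mem_head.
subst s'; have /ffunP/(_ s) := eqW; rewrite !ffunE eqxx => es.
have WW : W = W'.
  apply/ffunP => s'; have [->|ne] := eqVneq s' s.
    by rewrite -(rem_insert p (nb _ s WL)) es rem_insert // nb.
  by have /ffunP/(_ s') := eqW; rewrite !ffunE (negPf ne).
subst W'; suff -> : p = p' by [].
by rewrite -(index_insert (nb _ s WL) sW) es index_insert // nb.
Qed.

Lemma perm_arrs L L' : uniq L -> perm_eq L L' -> perm_eq (arrangements L) (arrangements L').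
Proof.
move=> uL LL'; apply: uniq_perm; rewrite ?uniq_arrs -?(perm_uniq LL') //.
by move=> W; apply/arrsP/arrsP => cW P; rewrite cW (seq.permP LL').
Qed.

Section Sums.
Variable M : nmodType.
Implicit Types F : {ffun 'I_n -> seq T} -> M.

Lemma sum_arrs_cons b L F :
  \sum_(W <- arrangements (b :: L)) F W =
  \sum_(W <- arrangements L) \sum_s \sum_(0 <= p < (size (W s)).+1) F (insert_at s p b W).
Proof.
rewrite /= big_allpairs_dep; apply: eq_bigr => W _.
by rewrite big_allpairs_dep big_enum; apply: eq_bigr => s _; rewrite /index_iota subn0.
Qed.

Lemma sum_arrs_perm L L' F : uniq L -> perm_eq L L' ->
  \sum_(W <- arrangements L) F W = \sum_(W <- arrangements L') F W.
Proof. by move=> uL LL'; apply/perm_big/perm_arrs. Qed.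

(** Double counting of the occurrences of a label in the word [s]: a label can
    be picked in an arrangement, or inserted in an arrangement of the others. *)
Lemma sum_arrs_pick s L (F : {ffun 'I_n -> seq T} -> T -> M) : uniq L ->
  \sum_(W <- arrangements L) \sum_(b <- W s) F W b =
  \sum_(b <- L) \sum_(W <- arrangements (rem b L))
    \sum_(0 <= p < (size (W s)).+1) F (insert_at s p b W) b.
Proof.
move=> uL; transitivity (\sum_(W <- arrangements L) \sum_(b <- L | b \in W s) F W b).
  rewrite !big_seq; apply: eq_bigr => W WL; rewrite -[RHS]big_filter.
  apply: perm_big; apply: uniq_perm; rewrite ?filter_uniq ?(arrs_uniq s uL WL) //.
  move=> x; rewrite mem_filter; case xs: (x \in W s) => //=.
  by rewrite (arrs_sub WL xs).
under eq_bigr do rewrite big_mkcond.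
rewrite exchange_big /= !big_seq; apply: eq_bigr => b bL.
rewrite (sum_arrs_perm _ uL (perm_to_rem bL)) sum_arrs_cons.
rewrite !big_seq; apply: eq_bigr => W WL.
have bW s' : b \notin W s'.
  apply/negP => /(arrs_sub WL); by rewrite mem_rem_uniq // !inE eqxx.
rewrite (bigD1 s) //= [X in _ + X]big1 ?addr0 => [|s' ne].
  by apply: eq_bigr => p _; rewrite ffunE eqxx mem_insert mem_head.
by rewrite big1 // => p _; rewrite ffunE eq_sym (negPf ne) (negPf (bW _)).
Qed.

End Sums.
End Arrangements.

(** * Inserting a label into a chain *)

Section Insertion.
Variables (K : fieldType) (k : nat) (t : 'rV[K]_k) (zs : K).
Hypotheses (t_inj : injective (t 0)) (t_zs : forall x, t 0 x != zs).
Local Notation chain := (omega_chain t zs).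

Lemma inv_sub_mul (x y b : K) : x != y -> x != b -> y != b ->
  (y - b)^-1 * (b - x)^-1 = (y - x)^-1 * ((b - x)^-1 - (b - y)^-1).
Proof.
move=> xy xb yb; have yx : y - x != 0 by rewrite subr_eq0 eq_sym.
have bx : b - x != 0 by rewrite subr_eq0 eq_sym.
have by_ : b - y != 0 by rewrite subr_eq0 eq_sym.
have yb' : y - b != 0 by rewrite subr_eq0.
by field; rewrite yx bx by_ yb'.
Qed.

Lemma sum_mulrB (w : seq 'I_k) (a f : 'I_k -> K) (e : K) :
  \sum_(x <- w) a x * (f x - e) = \sum_(x <- w) a x * f x - (\sum_(x <- w) a x) * e.
Proof. by rewrite big_distrl /= -sumrB; apply: eq_bigr => x _; rewrite mulrBr. Qed.

(** The case where [b] is placed after a given label [y], which suits an induction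
    on the word; [sum_insert] adds the first place. *)
Lemma sum_insert_after y b w lam (a : 'I_k -> K) : uniq (y :: b :: w) ->
  \sum_(0 <= p < (size w).+1)
     chain (y :: take p w ++ b :: drop p w) * (lam + \sum_(x <- drop p w) a x)
  = chain (y :: w)
    * (lam * ((t 0 b - zs)^-1 - (t 0 b - t 0 y)^-1)
       + \sum_(x <- w) a x * ((t 0 b - t 0 x)^-1 - (t 0 b - t 0 y)^-1)).
Proof.
elim: w y => [|x w IH] y.
  rewrite /= inE andbT => yb; rewrite big_nat1 /= !big_nil !addr0 !mulr1.
  by rewrite inv_sub_mul 1?eq_sym ?t_zs // ?(inj_eq t_inj) ?[b == y]eq_sym //; ring.
rewrite [uniq _]/= !inE !negb_or => /and3P[/and3P[yb yx yw] /andP[bx bw] /andP[xw uw]].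
have uxb : uniq (x :: b :: w) by rewrite /= !inE negb_or eq_sym bx xw bw uw.
rewrite big_nat_recl //.
under [X in _ + X]eq_bigr => p _ do rewrite /= -mulrA.
rewrite -big_distrr /= (IH _ uxb).
have e := @inv_sub_mul (t 0 x) (t 0 y) (t 0 b).
rewrite !(inj_eq t_inj) [x == y]eq_sym [x == b]eq_sym in e.
rewrite !mulrA e // !big_cons.
rewrite !sum_mulrB; ring.
Qed.

(** The sum over the places of [b] telescopes: placing [b] between [y] and [x]
    replaces 1/(y - x) by 1/((y - b) (b - x)), which is 1/(y - x) times the
    difference of 1/(b - x) and 1/(b - y). *)
Lemma sum_insert b w lam (a : 'I_k -> K) : uniq (b :: w) ->
  \sum_(0 <= p < (size w).+1)
     chain (take p w ++ b :: drop p w) * (lam + \sum_(x <- drop p w) a x)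
  = chain w * (lam / (t 0 b - zs) + \sum_(x <- w) a x / (t 0 b - t 0 x)).
Proof.
case: w => [|x w] ubw.
  by rewrite big_nat1 /= !big_nil; ring.
rewrite big_nat_recl // [X in _ + X]sum_insert_after; last first.
  move: ubw; rewrite /= !inE !negb_or => /andP[/andP[bx bw] /andP[xw uw]].
  by rewrite eq_sym bx xw bw uw.
rewrite drop0 take0 cat0s.
have -> : chain [:: b, x & w] = (t 0 b - t 0 x)^-1 * chain (x :: w) by [].
rewrite !big_cons.
rewrite !sum_mulrB; ring.
Qed.

End Insertion.

(** * A forest expansion of a Laplacian determinant *)

Section Ladder.
Variables (K : fieldType) (k : nat).
Implicit Types (y : 'I_k -> K) (p : 'I_k -> 'I_k -> K) (w : seq 'I_k).

(** Expanding the product chooses for each letter a parent: the site of the word,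
    with weight [y], or a later letter, with weight [p]. *)
Fixpoint ladder y p w : K :=
  if w is a :: w' then (y a + \sum_(x <- w') p a x) * ladder y p w' else 1.

(** The column [p^~ b] vanishes when [b] is nobody's parent. *)
Lemma ladder_insert y p b w q : (forall x, x \in w -> p x b = 0) ->
  ladder y p (take q w ++ b :: drop q w)
  = ladder y p w * (y b + \sum_(x <- drop q w) p b x).
Proof.
elim: w q => [|a w IH] [|q] pb /=; rewrite ?mulr1 ?mul1r //; first by rewrite mulrC.
rewrite IH => [|x xw]; last by rewrite pb // inE xw orbT.
rewrite big_cat big_cons /= pb ?mem_head // add0r -big_cat cat_take_drop; ring.
Qed.

Lemma ladder_eq0 y p w : w != [::] -> (forall x, x \in w -> y x = 0) ->
  ladder y p w = 0.
Proof.
elim: w => // a [|b w] IH _ y0; first by rewrite /= y0 ?mem_head // big_nil addr0 mul0r.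
rewrite [ladder _ _ _]/= -/(ladder y p (b :: w)) IH ?mulr0 // => x xw.
by apply: y0; rewrite inE xw orbT.
Qed.

Definition after (x : 'I_k) w := drop (index x w).+1 w.

Lemma ladder_prod y p w : uniq w ->
  ladder y p w = \prod_(x <- w) (y x + \sum_(l <- after x w) p x l).
Proof.
elim: w => [|a w IH] /=; first by rewrite big_nil.
move=> /andP[aw uw]; rewrite big_cons /after /= eqxx drop0 IH //; congr (_ * _).
rewrite !big_seq; apply: eq_bigr => x xw; rewrite /= ifF //.
by apply/eqP => ax; rewrite ax xw in aw.
Qed.

Lemma ladder_scale (m : 'I_k -> K) y p w :
  ladder (fun x => m x * y x) (fun x l => m x * p x l) w
  = \prod_(x <- w) m x * ladder y p w.
Proof.
elim: w => [|a w IH] /=; first by rewrite big_nil mulr1.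
by rewrite IH big_cons -big_distrr /=; ring.
Qed.

Lemma ladder_map (f : 'I_k -> 'I_k) y p w :
  ladder y p (map f w) = ladder (fun x => y (f x)) (fun x l => p (f x) (f l)) w.
Proof. by elim: w => //= a w ->; rewrite big_map. Qed.

End Ladder.

Lemma sum_count_mem (R : pzRingType) (T : finType) (f : T -> R) (w : seq T) :
  \sum_(x <- w) f x = \sum_x f x * (count_mem x w)%:R.
Proof.
elim: w => [|a w IH]; first by rewrite big_nil big1 // => x _; rewrite mulr0.
rewrite big_cons IH [in RHS](bigD1 a) //= eqxx natrD mulrDr mulr1 -addrA; congr (_ + _).
rewrite (bigD1 a) //=; congr (_ + _); apply: eq_bigr => x /negPf xa.
by rewrite eq_sym xa.
Qed.

Section Forest.
Variables (K : fieldType) (k n : nat) (t : 'rV[K]_k) (z : 'I_n -> K).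
Hypotheses (t_inj : injective (t 0)) (t_z : forall i s, t 0 i != z s).
Implicit Types (y : 'I_n -> 'I_k -> K) (p : 'I_k -> 'I_k -> K).
Implicit Types (W : {ffun 'I_n -> seq 'I_k}) (L : seq 'I_k).
Local Notation parent := ('I_k + 'I_n)%type.

Definition chain_ladder y p W :=
  \prod_s (omega_chain t (z s) (W s) * ladder (y s) p (W s)).

(** The Laplacian of the directed graph on the labels and the sites with edge
    weights [p] and [y] divided by the differences of the points, without the rows
    and columns of the sites. *)
Definition laplacian y p : 'M[K]_k := \matrix_(i, j)
  ((i == j)%:R * (\sum_s y s i / (t 0 i - z s) + \sum_l p i l / (t 0 i - t 0 l))
   - p i j / (t 0 i - t 0 j)).

(** Both sides of the forest expansion are linear in each of the rows
    [(y^~ i, p i)]; this is the expansion in the basis where every label [i]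
    has a single parent [f i]. *)

Definition weight_to y p i (v : parent) : K :=
  match v with inl l => p i l | inr s => y s i end.

Definition point (v : parent) : K :=
  match v with inl l => t 0 l | inr s => z s end.

Definition y_of (f : 'I_k -> parent) s i : K := (f i == inr s)%:R.
Definition p_of (f : 'I_k -> parent) i l : K := (f i == inl l)%:R.

Lemma weight_to_of f i v : weight_to (y_of f) (p_of f) i v = (f i == v)%:R.
Proof. by case: v. Qed.

Definition edge_mx i j (v : parent) : K :=
  ((i == j)%:R - (v == inl j)%:R) / (t 0 i - point v).

Lemma laplacianE y p i j :
  laplacian y p i j = \sum_v weight_to y p i v * edge_mx i j v.
Proof.
rewrite mxE big_sumType /= [in RHS]addrC mulrDr -addrA; congr (_ + _).
  rewrite big_distrr; apply: eq_bigr => s _.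
  by rewrite /edge_mx /= subr0 mulrCA.
rewrite (bigD1 j) // [in RHS](bigD1 j) //= /edge_mx /= eqxx.
rewrite mulrDr addrAC; congr (_ + _); first by rewrite -[true%:R]/(1 : K); ring.
rewrite big_distrr; apply: eq_bigr => l /negPf lj.
by rewrite [_ == inl j]lj subr0 mulrCA.
Qed.

Lemma det_laplacian_expand y p :
  \det (laplacian y p) =
  \sum_(f : {ffun 'I_k -> parent})
     (\prod_i weight_to y p i (f i)) * \det (laplacian (y_of f) (p_of f)).
Proof.
transitivity (\sum_(f : {ffun 'I_k -> parent}) \sum_(s : 'S_k)
    (-1) ^+ s * \prod_i (weight_to y p i (f i) * edge_mx i (s i) (f i))).
  rewrite exchange_big; apply: eq_bigr => s _; rewrite -big_distrr /=.
  rewrite -(bigA_distr_bigA (fun i v => weight_to y p i v * edge_mx i (s i) v)).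
  by congr (_ * _); apply: eq_bigr => i _; rewrite laplacianE.
apply: eq_bigr => f _; rewrite big_distrr; apply: eq_bigr => s _ /=.
rewrite big_split mulrCA; congr (_ * (_ * _)); apply: eq_bigr => i _.
rewrite laplacianE (bigD1 (f i)) //= weight_to_of eqxx mul1r big1 ?addr0 //.
by move=> v /negPf; rewrite weight_to_of eq_sym => ->; rewrite mul0r.
Qed.

(** Compatibility of the parent [v] of [i] with [W], with values in the field
    because it serves as a coefficient. *)
Definition allowed W i (v : parent) : K :=
  match v with
  | inl l => \sum_s (i \in W s)%:R * (count_mem l (after i (W s)))%:R
  | inr s => (i \in W s)%:R
  end.

Lemma ladders_prod y p W : W \in arrangements n (enum 'I_k) ->
  \prod_s ladder (y s) p (W s)
  = \prod_i \sum_v weight_to y p i v * allowed W i v.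
Proof.
move=> WA; have uW s := arrs_uniq s (enum_uniq _) WA.
transitivity (\prod_i \prod_s
    if i \in W s then y s i + \sum_(l <- after i (W s)) p i l else 1).
  rewrite exchange_big; apply: eq_bigr => s _.
  by rewrite ladder_prod // big_uniq // big_mkcond.
apply: eq_bigr => i _.
have [s0 is0] : exists s, i \in W s.
  by apply/existsP; rewrite -(arrs_mem i WA) mem_enum.
have others s : s != s0 -> (i \in W s) = false.
  move=> ne; apply/negP => is_; move/eqP: ne; apply.
  exact: arrs_disjoint (enum_uniq _) WA is_ is0.
rewrite (bigD1 s0) //= is0 [X in _ * X]big1 ?mulr1 => [|s /others->//].
rewrite big_sumType /= addrC; congr (_ + _).
  rewrite (bigD1 s0) //= is0 mulr1 big1 ?addr0 // => s /others->.
  by rewrite mulr0.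
rewrite sum_count_mem; apply: eq_bigr => l _; rewrite (bigD1 s0) //= is0 mul1r.
by rewrite big1 ?addr0 // => s /others->; rewrite mul0r.
Qed.

Lemma ladders_expand y p W : W \in arrangements n (enum 'I_k) ->
  \prod_s ladder (y s) p (W s) =
  \sum_(f : {ffun 'I_k -> parent})
     (\prod_i weight_to y p i (f i)) * \prod_s ladder (y_of f s) (p_of f) (W s).
Proof.
move=> WA; rewrite ladders_prod // bigA_distr_bigA; apply: eq_bigr => f _.
rewrite big_split ladders_prod //; congr (_ * _); apply: eq_bigr => i _.
rewrite (bigD1 (f i)) //= weight_to_of eqxx mul1r big1 ?addr0 //.
by move=> v /negPf; rewrite weight_to_of eq_sym => ->; rewrite mul0r.
Qed.

Section Parents.
Variable f : 'I_k -> parent.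

(** The Laplacian of [f] on the labels of [L], extended by the identity so that
    all the sets of labels are handled in the same matrix space. *)
Definition forest_mx L : 'M[K]_k :=
  \matrix_(i, j) if i \in L then edge_mx i j (f i) else (i == j)%:R.

Lemma chain_ladder_ins L b s q W : W \in arrangements n L ->
  (forall x, x \in L -> f x != inl b) ->
  chain_ladder (y_of f) (p_of f) (insert_at s q b W) =
  \prod_(s' | s' != s) (omega_chain t (z s') (W s') * ladder (y_of f s') (p_of f) (W s'))
  * ladder (y_of f s) (p_of f) (W s)
  * (omega_chain t (z s) (take q (W s) ++ b :: drop q (W s))
     * (y_of f s b + \sum_(x <- drop q (W s)) p_of f b x)).
Proof.
move=> WL nf; rewrite /chain_ladder (bigD1 s) //= ffunE eqxx ladder_insert => [|x xs].
  rewrite mulrC [X in X * _ = _](_ : _ = \prod_(s' | s' != s)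
    (omega_chain t (z s') (W s') * ladder (y_of f s') (p_of f) (W s'))); first by ring.
  by apply: eq_bigr => s' /negPf ne; rewrite ffunE ne.
by rewrite /p_of (negPf (nf _ (arrs_sub WL xs))).
Qed.

(** The presence of a leaf [b] does not restrict the other labels; its own place
    must come before its parent in the same word, or be anywhere in the word of
    its parent site, and [sum_insert] adds up these places. *)
Lemma sum_insert_leaf L b W : uniq (b :: L) -> W \in arrangements n L ->
  (forall x, x \in L -> f x != inl b) ->
  (forall l, f b = inl l -> l \in L) ->
  \sum_s \sum_(0 <= q < (size (W s)).+1)
     chain_ladder (y_of f) (p_of f) (insert_at s q b W)
  = (t 0 b - point (f b))^-1 * chain_ladder (y_of f) (p_of f) W.
Proof.
move=> ubL WL nf fb; have /andP[bL uL] : (b \notin L) && uniq L by [].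
transitivity (\sum_s chain_ladder (y_of f) (p_of f) W *
   (y_of f s b / (t 0 b - z s) + \sum_(x <- W s) p_of f b x / (t 0 b - t 0 x))).
  apply: eq_bigr => s _.
  have ubs : uniq (b :: W s).
    rewrite /= (arrs_uniq s uL WL) andbT; apply: contra bL; exact: arrs_sub.
  under eq_bigr do rewrite (chain_ladder_ins _ _ WL nf).
  rewrite -big_distrr /= sum_insert // /chain_ladder [in RHS](bigD1 s) //=; ring.
rewrite -big_distrr mulrC; congr (_ * _); rewrite big_split /=.
case fbE: (f b) => [l|s0] /=; last first.
  rewrite (bigD1 s0) //= /y_of fbE eqxx mul1r big1 => [|s /negPf ne].
    rewrite addr0 big1 ?addr0 // => s _; rewrite big1 // => x _.
    by rewrite /p_of fbE mul0r.
  by rewrite [_ == _]eq_sym [_ == _]ne mul0r.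
rewrite big1 ?add0r => [|s _]; last by rewrite /y_of fbE mul0r.
have /existsP[s0 ls0] : [exists s, l \in W s] by rewrite -(arrs_mem l WL) fb.
have us := arrs_uniq _ uL WL.
rewrite (bigD1 s0) //= [X in _ + X]big1 => [|s ne]; last first.
  rewrite big_seq big1 // => x xs; rewrite /p_of fbE.
  case: eqP => [[lx]|]; last by rewrite mul0r.
  by move: ne; rewrite (arrs_disjoint uL WL xs (s' := s0)) ?eqxx // -lx.
rewrite addr0 (bigD1_seq l) //= /p_of fbE eqxx mul1r big1 ?addr0 // => x /negPf xl.
by rewrite [_ == _]eq_sym [_ == _]xl mul0r.
Qed.

Lemma det_forest_leaf L b : b \notin L ->
  (forall x, x \in L -> f x != inl b) -> f b != inl b ->
  \det (forest_mx (b :: L)) = (t 0 b - point (f b))^-1 * \det (forest_mx L).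
Proof.
move=> bL nf fb; rewrite (expand_det_col _ b) [in RHS](expand_det_col _ b).
have col0 L' i : {subset L' <= b :: L} -> i != b -> forest_mx L' i b = 0.
  move=> sub /negPf ib; rewrite mxE ib; case: ifP => // /sub; rewrite inE ib => /nf/negPf iL.
  by rewrite /edge_mx ib iL subr0 mul0r.
rewrite (bigD1 b) //= [in RHS](bigD1 b) //= !big1 ?addr0; last first.
- by move=> i ib; rewrite col0 ?mul0r.
- by move=> i ib; rewrite col0 ?mul0r // => x xL; rewrite inE xL orbT.
rewrite !mxE mem_head (negPf bL) eqxx mul1r /edge_mx eqxx (negPf fb) subr0 mul1r.
congr (_ * (_ * \det _)); apply/matrixP => i j; rewrite !mxE inE.
by rewrite eq_sym (negPf (neq_lift _ _)).
Qed.

(** Without leaves, [f] permutes the labels of [L], no arrangement is compatible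
    with it and the Laplacian kills the indicator of [L]. *)
Lemma no_leaf L x : uniq L -> (forall b, b \in L -> inl b \in map f L) ->
  x \in L -> f x \in map inl L.
Proof.
move=> uL leaf xL; have sub : {subset map inl L <= map f L}.
  by move=> _ /mapP[b bL ->]; exact: leaf.
have uL' : uniq [seq (inl b : parent) | b <- L] by rewrite map_inj_uniq // => ? ? [].
have [|_ ->] := uniq_min_size uL' sub; first by rewrite !size_map.
exact: map_f.
Qed.

Lemma det_forest_no_leaf L : L != [::] ->
  (forall x, x \in L -> f x \in map inl L) -> \det (forest_mx L) = 0.
Proof.
case: L => // a L _ fL; apply/eqP; rewrite -det_tr; apply/det0P.
have sum1 (l : 'I_k) : \sum_j (j \in a :: L)%:R * (l == j)%:R = (l \in a :: L)%:R :> K.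
  rewrite (bigD1 l) //= eqxx mulr1 big1 ?addr0 // => j.
  by rewrite eq_sym => /negPf->; rewrite mulr0.
exists (\row_j (j \in a :: L)%:R).
  by apply/eqP => /rowP/(_ a)/eqP; rewrite !mxE mem_head oner_eq0.
apply/rowP => i; rewrite !mxE.
under eq_bigr do rewrite !mxE.
case: (boolP (i \in a :: L)) => iL; last by rewrite sum1 (negPf iL).
have /mapP[l lL fi] := fL i iL.
rewrite (eq_bigr (fun j => ((j \in a :: L)%:R * (i == j)%:R
   - (j \in a :: L)%:R * (l == j)%:R) / (t 0 i - point (f i)))).
  by rewrite -big_distrl sumrB !sum1 iL lL subrr /= mul0r.
by move=> j _; rewrite /edge_mx fi mulrA mulrBr.
Qed.

(** The expansion for a single choice of parents, by removing leaves one at a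
    time. *)
Lemma sum_chain_ladder L : uniq L ->
  (forall x l, x \in L -> f x = inl l -> l \in L) ->
  \sum_(W <- arrangements n L) chain_ladder (y_of f) (p_of f) W = \det (forest_mx L).
Proof.
have [m] := ubnP (size L); elim: m => // m IH in L *; rewrite ltnS => Lm uL fL.
have [->|L0] := eqVneq L [::].
  rewrite /= big_seq1 /chain_ladder big1 => [|s _]; last by rewrite ffunE mulr1.
  by rewrite -(det1 _ k); congr (\det _); apply/matrixP => i j; rewrite !mxE.
have [/allP leaf|/allPn[b bL leaf]] := boolP (all (fun b => inl b \in map f L) L).
  have fin := no_leaf uL leaf.
  rewrite det_forest_no_leaf // big_seq big1 // => W WL.
  have /existsP[s Ws] : [exists s, W s != [::]].
    case: L L0 WL {uL fL leaf fin Lm} => // a L _ WL.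
    have := arrs_mem a WL; rewrite mem_head => /esym/existsP[s].
    by case Ws: (W s) => // _; apply/existsP; exists s; rewrite Ws.
  rewrite /chain_ladder (bigD1 s) //= ladder_eq0 ?mulr0 ?mul0r // => x xs.
  by rewrite /y_of; have /mapP[l _ ->] := fin x (arrs_sub WL xs).
have nf x : x \in L -> f x != inl b.
  by move=> xL; apply: contra leaf => /eqP <-; apply: map_f.
have Lb := perm_to_rem bL; have uL' : uniq (b :: rem b L) by rewrite -(perm_uniq Lb).
have sub x : x \in rem b L -> x \in L by apply: mem_rem.
rewrite (sum_arrs_perm _ uL Lb) sum_arrs_cons.
have -> : forest_mx L = forest_mx (b :: rem b L).
  by apply/matrixP => i j; rewrite !mxE (perm_mem Lb).
rewrite det_forest_leaf ?nf //; last 2 first.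
- by case/andP: uL'.
- by move=> x /sub/nf.
have fb l : f b = inl l -> l \in rem b L.
  move=> fbl; rewrite mem_rem_uniq // !inE (fL b) // andbT.
  by have := nf b bL; rewrite fbl; apply: contra => /eqP->.
have uL'' : uniq (rem b L) by case/andP: uL'.
rewrite -IH //; first last.
- move=> x l xL fx; have := fL x l (sub x xL) fx.
  rewrite (perm_mem Lb) inE => /orP[/eqP lb|//].
  by have := nf x (sub x xL); rewrite fx lb eqxx.
- rewrite size_rem //; by case: (L) L0 Lm.
rewrite big_distrr /= !big_seq; apply: eq_bigr => W WL.
by rewrite (sum_insert_leaf uL' WL _ fb) // => x /sub/nf.
Qed.

End Parents.

(** A form of the matrix-tree theorem: the determinant is the sum over the forests
    rooted at the sites, and the arrangements compatible with a forest have chains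
    that add up to the product of the edges of the forest. *)
Theorem forest_expansion y p :
  \sum_(W <- arrangements n (enum 'I_k)) chain_ladder y p W = \det (laplacian y p).
Proof.
rewrite det_laplacian_expand.
transitivity (\sum_(W <- arrangements n (enum 'I_k)) \sum_(f : {ffun 'I_k -> parent})
   (\prod_i weight_to y p i (f i)) * chain_ladder (y_of f) (p_of f) W).
  rewrite !big_seq; apply: eq_bigr => W WA; rewrite /chain_ladder big_split /=.
  rewrite ladders_expand // big_distrr; apply: eq_bigr => f _ /=.
  by rewrite big_split /= mulrCA.
rewrite exchange_big; apply: eq_bigr => f _; rewrite -big_distrr; congr (_ * _).
rewrite /= sum_chain_ladder ?enum_uniq //; last by move=> *; rewrite mem_enum.
congr (\det _); apply/matrixP => i j; rewrite mxE mem_enum laplacianE.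
rewrite (bigD1 (f i)) //= weight_to_of eqxx mul1r big1 ?addr0 //.
by move=> v /negPf; rewrite weight_to_of eq_sym => ->; rewrite mul0r.
Qed.

End Forest.


(** * Relabelling *)

Section Relabelling.
Variables (n k : nat).
Implicit Types (W : {ffun 'I_n -> seq 'I_k}) (s : 'S_k).
Local Notation full := (arrangements n (enum 'I_k)).

Definition relabel (f : 'I_k -> 'I_k) W : {ffun 'I_n -> seq 'I_k} :=
  [ffun u => map f (W u)].

Definition content W := flatten [seq W u | u <- enum 'I_n].

Lemma count_content P W : count P (content W) = (\sum_u count P (W u))%N.
Proof. by rewrite count_flatten sumnE !big_map. Qed.

Lemma full_content W : W \in full -> perm_eq (content W) (enum 'I_k).
Proof. by move=> /arrsP cW; apply/seq.permP => P; rewrite count_content cW. Qed.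

Lemma relabel_full s W : W \in full -> relabel s W \in full.
Proof.
move=> /arrsP cW; apply/arrsP => P.
transitivity (\sum_u count (preim s P) (W u))%N.
  by apply: eq_bigr => u _; rewrite ffunE count_map.
rewrite cW -count_map; apply/seq.permP; apply: uniq_perm.
- by rewrite map_inj_uniq ?enum_uniq //; apply: perm_inj.
- exact: enum_uniq.
by move=> x; rewrite mem_enum -(permKV s x) map_f // mem_enum.
Qed.

Lemma relabel_inj W : W \in full -> injective (fun s : 'S_k => relabel s W).
Proof.
move=> WA s s' eW; apply/permP => i.
have /existsP[u iu] : [exists u, i \in W u] by rewrite -(arrs_mem i WA) mem_enum.
have /ffunP/(_ u) := eW; rewrite !ffunE => /eq_in_map; exact.
Qed.

Lemma relabel_exists W0 W : W0 \in full -> W \in full ->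
  (forall u, size (W u) = size (W0 u)) -> exists s : 'S_k, W = relabel s W0.
Proof.
move=> W0A WA szW; set e0 := content W0; set e := content W.
have pe0 : perm_eq e0 _ := full_content W0A; have pe : perm_eq e _ := full_content WA.
have ue0 : uniq e0 by rewrite (perm_uniq pe0) enum_uniq.
have ue : uniq e by rewrite (perm_uniq pe) enum_uniq.
have sze : size e = size e0 by rewrite (perm_size pe) (perm_size pe0).
have ine0 x : x \in e0 by rewrite (perm_mem pe0) mem_enum.
pose f x := nth x e (index x e0).
have f_inj : injective f.
  move=> x y; rewrite /f (set_nth_default x y) ?sze ?index_mem // => /eqP.
  rewrite nth_uniq ?sze ?index_mem // => /eqP ixy.
  by rewrite -(nth_index x (ine0 x)) ixy nth_index.
exists (perm f_inj).
have eq_e : map (perm f_inj) e0 = e.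
  case: (pickP 'I_k) => [x0 _|none]; last first.
    case: (e0) (sze) => [|x]; last by have := none x.
    by case: (e).
  apply: (@eq_from_nth _ x0); rewrite size_map ?sze // => i ilt.
  rewrite (nth_map x0) // permE /f index_uniq //.
  by apply: set_nth_default; rewrite sze.
have : [seq W u | u <- enum 'I_n] = [seq map (perm f_inj) (W0 u) | u <- enum 'I_n].
  apply: eq_from_flatten_shape; last first.
    by rewrite /shape -!map_comp; apply: eq_map => u /=; rewrite size_map szW.
  by rewrite -[LHS]/e -eq_e /e0 /content map_flatten -map_comp.
by move=> /eq_in_map eqW; apply/ffunP => u; rewrite ffunE eqW ?mem_enum.
Qed.

(** The symmetric group acts simply transitively on the arrangements of all the
    labels with given word lengths. *)
Lemma sum_relabel (M : nmodType) (F : {ffun 'I_n -> seq 'I_k} -> M) W0 (P : pred _) :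
  W0 \in full -> (forall W, P W -> forall u, size (W u) = size (W0 u)) ->
  \sum_(s : 'S_k | P (relabel s W0)) F (relabel s W0) = \sum_(W <- full | P W) F W.
Proof.
move=> W0A Psz; rewrite -[RHS]big_filter.
rewrite -(big_map (fun s : 'S_k => relabel s W0) P F) -big_filter; apply: perm_big.
apply: uniq_perm; rewrite ?filter_uniq ?uniq_arrs ?enum_uniq //.
  rewrite map_inj_uniq ?index_enum_uniq //; exact: relabel_inj.
move=> W; rewrite !mem_filter; apply: andb_id2l => PW; apply/mapP/idP => [[s _ ->]|WA].
  exact: relabel_full.
by have [s ->] := relabel_exists W0A WA (Psz W PW); exists s; rewrite ?mem_index_enum.
Qed.

End Relabelling.

(** * Simple Lie algebras with Chevalley generators *)

(** Closure properties are easier to state for predicates; classically, these are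
    the same as subspaces in finite dimension. *)
Lemma linear_set_vspace (K : fieldType) (V : vectType K) (P : V -> Prop) :
  P 0 -> (forall a u v, P u -> P v -> P (a *: u + v)) ->
  exists U : {vspace V}, forall x, x \in U <-> P x.
Proof.
move=> P0 PL.
pose Q m := `[< exists U : {vspace V}, \dim U = m /\ forall x, x \in U -> P x >].
have exQ : exists m, Q m.
  exists 0%N; apply/asboolP; exists 0%VS; split; first by rewrite dimv0.
  by move=> x; rewrite memv0 => /eqP->.
have ubQ m : Q m -> (m <= \dim {: V})%N.
  by move=> /asboolP[U [<- _]]; apply/dimvS/subvf.
case: (ex_maxnP exQ ubQ) => m /asboolP[U [dU UP]] max; exists U => x; split; first exact: UP.
move=> Px; have : Q (\dim (U + <[x]>)).
  apply/asboolP; exists (U + <[x]>)%VS; split=> // _ /memv_addP[u uU [_ /vlineP[a ->] ->]].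
  by rewrite addrC; apply: PL => //; apply: UP.
move=> /max; rewrite -dU => le; have /eqP -> : U == (U + <[x]>)%VS.
  by rewrite eqEdim addvSl.
by apply: (subvP (addvSr U <[x]>)); apply: memv_line.
Qed.

Section LieFacts.
Variables (K : fieldType) (g : lie_algebra K).
Implicit Types x y w : g.

Lemma bracketC x y : bracket x y = - bracket y x.
Proof.
have := bracket_alt (x + y); rewrite linearDl !linearDr !bracket_alt add0r addr0.
by move/eqP; rewrite addr_eq0 => /eqP.
Qed.

Lemma bracket_derivation x y w :
  bracket x (bracket y w) = bracket (bracket x y) w + bracket y (bracket x w).
Proof.
have /eqP := bracket_jacobi x y w.
rewrite (bracketC w (bracket x y)) (bracketC w x) linearNr.
by rewrite subr_eq0 => /eqP <-; rewrite subrK.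
Qed.

End LieFacts.

Section Chevalley.
Variables (K : numFieldType) (r : nat) (g : simple_lie_algebra K r).
Implicit Types (x y w : g) (P : g -> Prop).
Local Notation E := (gE g).
Local Notation F := (gF g).
Local Notation alpha := (sroot g).

Definition linear_set P := P 0 /\ forall a u v, P u -> P v -> P (a *: u + v).

Lemma generated P : linear_set P ->
  (forall x y, P x -> P y -> P (bracket x y)) ->
  (forall i, [/\ P (E i), P (F i) & P (vsval (gH g i))]) -> forall x, P x.
Proof.
move=> [P0 PL] PB PG x; have [U UP] := linear_set_vspace P0 PL.
have Uf : U = fullv.
  apply: (@chevalley_gen _ _ g) => [u v /UP Pu /UP Pv|i]; first exact/UP/PB.
  by have [? ? ?] := PG i; split; apply/UP.
by apply/UP; rewrite Uf memvf.
Qed.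

(** The elements whose adjoint action preserves [P] form a subalgebra. *)
Lemma ideal_generated P : linear_set P ->
  (forall i x, P x ->
     [/\ P (bracket (E i) x), P (bracket (F i) x) & P (bracket (vsval (gH g i)) x)]) ->
  forall y x, P x -> P (bracket y x).
Proof.
move=> [P0 PL] PG; apply: generated => [|u v Pu Pv x Px|i].
- split=> [x _|a u v Pu Pv x Px]; first by rewrite linear0l.
  by rewrite linearPl; apply: PL; [apply: Pu|apply: Pv].
- have -> : bracket (bracket u v) x = -1 *: bracket v (bracket u x) + bracket u (bracket v x).
    by rewrite (bracket_derivation u v) scaleN1r addrC addrK.
  by apply: PL; [apply/Pv/Pu|apply/Pu/Pv].
by split=> x /(PG i)[].
Qed.

Lemma line_not_ideal e : (forall y, exists a, bracket y e = a *: e) -> e = 0.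
Proof.
move=> stab; have [[x [y xy]] simp] := sla_simple g.
have [|e0|ef] := simp <[e]>%VS.
- move=> u v /vlineP[a ->]; rewrite linearZr_LR /=; have [b ->] := stab u.
  by rewrite scalerA; apply/vlineP; exists (a * b).
- by apply/eqP; rewrite -memv0 -e0 memv_line.
have /vlineP[a xe] : x \in <[e]>%VS by rewrite ef memvf.
have /vlineP[b ye] : y \in <[e]>%VS by rewrite ef memvf.
by move: xy; rewrite xe ye linearZl_LR linearZr_LR bracket_alt !scaler0 eqxx.
Qed.

Lemma weight_separates (x : subvs_of (sla_h g)) :
  (forall mu : hweight g, mu x = 0) -> x = 0.
Proof.
move=> mux; rewrite (coord_vbasis (memvf x)) big1 // => i _.
by have := mux (linfun (coord (vbasis fullv) i)); rewrite lfunE /= => ->; rewrite scale0r.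
Qed.

Lemma dual_roots : exists y : 'I_r -> subvs_of (sla_h g),
  forall i j, alpha i (y j) = (i == j)%:R.
Proof.
have [_ fr _] := sroot_simple g.
pose e := vbasis {: subvs_of (sla_h g)}.
pose A := \matrix_(i < r, l < \dim {: subvs_of (sla_h g)}) (alpha i e`_l : K).
have : row_free A.
  apply: inj_row_free => v vA; apply/rowP => i; rewrite mxE.
  have /freeP/(_ (v 0)) := fr; apply.
  apply/lfunP => x; rewrite zero_lfunE sum_lfunE (coord_vbasis (memvf x)).
  under eq_bigr do rewrite nth_mktuple scale_lfunE linear_sum scaler_sumr.
  rewrite exchange_big big1 // => l _.
  under eq_bigr do rewrite linearZ scalerA mulrC -scalerA.
  rewrite -scaler_sumr; have /rowP/(_ l) := vA; rewrite !mxE => s0.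
  rewrite -[RHS](scaler0 _ (coord e l x)) -{}[in RHS]s0; congr (_ *: _).
  by apply: eq_bigr => j _; rewrite mxE.
move=> /row_freeP[B AB]; exists (fun j => \sum_l B l j *: e`_l) => i j.
have /matrixP/(_ i j) := AB; rewrite !mxE => <-; rewrite linear_sum.
by apply: eq_bigr => l _; rewrite linearZ mxE mulrC.
Qed.

End Chevalley.

Section Triangular.
Variables (K : numFieldType) (r : nat) (g : simple_lie_algebra K r).
Implicit Types (x y w : g) (P : g -> Prop).
Local Notation E := (gE g).
Local Notation F := (gF g).
Local Notation alpha := (sroot g).

Lemma wform_sym (lam mu : hweight g) : wform lam mu = wform mu lam.
Proof. by rewrite /wform -!hsharpP sla_form_sym. Qed.

(** If [alpha i] were isotropic, then the coroot [gH i] would be zero, hence also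
    [gE i] and [gF i], because they span ideals; then the element of the Cartan
    subalgebra dual to [alpha i] would be central, and [alpha i] not a root. *)
Lemma sroot_anisotropic i : wform (alpha i) (alpha i) != 0.
Proof.
apply/negP => /eqP iso; rewrite /wform in iso.
have H0 : gH g i = 0.
  by apply: weight_separates => mu; rewrite gH_coroot iso invr0 mulr0.
have cartan0 j : cartan_mx g i j = 0.
  apply/eqP; have := cartan_mxE g i j; rewrite H0 linear0 => /eqP.
  by rewrite intr_eq0.
have line_stable e : (forall j, exists a, bracket (E j) e = a *: e) ->
    (forall j, exists a, bracket (F j) e = a *: e) ->
    (forall j, exists a, bracket (vsval (gH g j)) e = a *: e) -> e = 0.
  move=> Ee Fe He; apply: (line_not_ideal (g := g)) => y.
  have lin : linear_set (fun x => exists a : K, x = a *: e).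
    split=> [|a _ _ [b ->] [c ->]]; first by exists 0; rewrite scale0r.
    by exists (a * b + c); rewrite scalerDl scalerA.
  apply: (ideal_generated lin) => [j _ [a ->]|]; last by exists 1; rewrite scale1r.
  rewrite !linearZr_LR /=; have [b ->] := Ee j; have [c ->] := Fe j.
  by have [d ->] := He j; split; rewrite scalerA; eexists.
have E0 : E i = 0.
  apply: line_stable => j; last by exists (alpha i (gH g j)); rewrite ghE.
    exists 0; rewrite scale0r; have [->|ne] := eqVneq j i; first by rewrite bracket_alt.
    have := @serreE _ _ g i j; rewrite eq_sym cartan0 subr0 /= => /(_ ne) Sij.
  by rewrite bracketC Sij oppr0.
  exists 0; rewrite scale0r bracketC gEF; case: eqP => _; last by rewrite oppr0.
  by rewrite H0 !linear0.
have F0 : F i = 0.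
  apply: line_stable => j; last by exists (- alpha i (gH g j)); rewrite ghF.
    exists 0; rewrite scale0r gEF; case: eqP => // ->.
    by rewrite H0 linear0.
  exists 0; rewrite scale0r; have [->|ne] := eqVneq j i; first by rewrite bracket_alt.
  have := @serreF _ _ g i j; rewrite eq_sym cartan0 subr0 /= => /(_ ne) Sij.
  by rewrite bracketC Sij oppr0.
have [y dual] := dual_roots g.
have central x : bracket (vsval (y i)) x = 0.
  move: x; apply: generated.
  - split=> [|a u v u0 v0]; first by rewrite linear0r.
    by rewrite linearPr u0 v0 scaler0 addr0.
  - by move=> u v u0 v0; rewrite bracket_derivation u0 v0 linear0l linear0r addr0.
  move=> j; rewrite sla_hC ghE ghF dual; have [->|ne] := eqVneq j i.
    by rewrite E0 F0 !scaler0.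
  by rewrite oppr0 !scale0r.
have [/(_ i)[_ [x [x0 rx]]] _ _] := sroot_simple g.
by move: x0; have := rx (y i); rewrite central dual eqxx scale1r => <-; rewrite eqxx.
Qed.

(** This is where the normalization of the form enters: it turns the coroots, which
    appear in the action of the Chevalley generators, into the values of the form,
    which appear in the master function. *)
Lemma coroot_wform (mu : hweight g) i :
  wform (alpha i) (alpha i) / 2 * mu (gH g i) = wform (alpha i) mu.
Proof.
rewrite wform_sym gH_coroot /wform.
have := sroot_anisotropic i; rewrite /wform.
set a := (alpha i) _; set b := mu _ => a0; move: b; rewrite /GRing.regular /= => b.
by field; rewrite a0.
Qed.

(** The subalgebra generated by the [e i]; right-nested brackets suffice. *)
Inductive nested (e : 'I_r -> g) : g -> Prop :=
| nested0 : nested e 0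
| nested_lin a x y : nested e x -> nested e y -> nested e (a *: x + y)
| nested_gen i : nested e (e i)
| nested_bracket i x : nested e x -> nested e (bracket (e i) x).

Lemma nested_linear e : linear_set (nested e).
Proof. by split; [exact: nested0 | move=> *; exact: nested_lin]. Qed.

Lemma linear_setD P : linear_set P -> forall x y, P x -> P y -> P (x + y).
Proof. by move=> [_ PL] x y Px Py; rewrite -(scale1r x); apply: PL. Qed.

Lemma linear_setZ P : linear_set P -> forall a x, P x -> P (a *: x).
Proof. by move=> [P0 PL] a x Px; rewrite -[_ *: _]addr0; apply: PL. Qed.

Lemma nested_cartan e (wt : 'I_r -> hweight g) :
  (forall (h : subvs_of (sla_h g)) i, bracket (vsval h) (e i) = wt i h *: e i) ->
  forall (h : subvs_of (sla_h g)) x, nested e x -> nested e (bracket (vsval h) x).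
Proof.
move=> he h x; have lin := nested_linear e; elim=> [|a u v _ IHu _ IHv|i|i u nu IHu].
- by rewrite linear0r; apply: nested0.
- by rewrite linearPr; apply: nested_lin.
- by rewrite he; apply: (linear_setZ lin); apply: nested_gen.
rewrite bracket_derivation he linearZl_LR.
by apply: nested_lin; apply: nested_bracket.
Qed.

Lemma nested_opposite e f (wt : 'I_r -> hweight g)
    (u : 'I_r -> 'I_r -> subvs_of (sla_h g)) :
  (forall (h : subvs_of (sla_h g)) i, bracket (vsval h) (e i) = wt i h *: e i) ->
  (forall i j, bracket (f j) (e i) = vsval (u j i)) ->
  forall j x, nested e x -> exists (h : subvs_of (sla_h g)) x',
    nested e x' /\ bracket (f j) x = vsval h + x'.
Proof.
move=> he fe j x; have lin := nested_linear e.
elim=> [|a y w _ [h [y' [ny ey]]] _ [h' [w' [nw ew]]]|i|i y ny [h [y' [ny' ey]]]].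
- by exists 0, 0; split; [exact: nested0 | rewrite linear0r linear0 addr0].
- exists (a *: h + h'), (a *: y' + w'); split; first exact: nested_lin.
  by rewrite linearPr ey ew linearP scalerDr /= addrACA.
- by exists (u j i), 0; split; [exact: nested0 | rewrite fe addr0].
exists 0, (bracket (vsval (u j i)) y + bracket (e i) (vsval h + y')); split; last first.
  by rewrite linear0 add0r bracket_derivation fe ey.
rewrite linearDr; apply: (linear_setD lin); first exact: nested_cartan ny.
apply: (linear_setD lin); last exact: nested_bracket.
by rewrite bracketC he -scaleNr; apply: (linear_setZ lin); apply: nested_gen.
Qed.

(** The sum of the three parts is an ideal, because it is stable under the
    Chevalley generators, and it contains them. *)
Lemma triangular x : exists a (h : subvs_of (sla_h g)) b,
  [/\ nested E a, nested F b & x = a + vsval h + b].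
Proof.
pose W x := exists a (h : subvs_of (sla_h g)) b,
  [/\ nested E a, nested F b & x = a + vsval h + b].
have linE := nested_linear E; have linF := nested_linear F.
have linW : linear_set W.
  split=> [|a _ _ [a1 [h1 [b1 [nE1 nF1 ->]]]] [a2 [h2 [b2 [nE2 nF2 ->]]]]].
    exists 0, 0, 0; split; [exact: nested0|exact: nested0|by rewrite linear0 !addr0].
  exists (a *: a1 + a2), (a *: h1 + h2), (a *: b1 + b2).
  split; [exact: nested_lin|exact: nested_lin|].
  by rewrite linearP !scalerDr addrACA; congr (_ + _); rewrite addrACA.
have wE (h : subvs_of (sla_h g)) i := ghE h i.
have wF (h : subvs_of (sla_h g)) i : bracket (vsval h) (F i) = (- alpha i) h *: F i.
  by rewrite ghF opp_lfunE.
have FE i j : bracket (F j) (E i) = vsval (if i == j then - gH g i else 0).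
  by rewrite bracketC gEF; case: eqP => _; rewrite ?linearN ?linear0 ?oppr0.
have EF i j : bracket (E j) (F i) = vsval (if j == i then gH g j else 0).
  by rewrite gEF; case: eqP => _; rewrite ?linear0.
have genW i : [/\ W (E i), W (F i) & W (vsval (gH g i))].
  split.
  - exists (E i), 0, 0; split; [exact: nested_gen|exact: nested0|by rewrite linear0 !addr0].
  - exists 0, 0, (F i); split; [exact: nested0|exact: nested_gen|by rewrite linear0 !add0r].
  exists 0, (gH g i), 0; split; [exact: nested0|exact: nested0|by rewrite add0r addr0].
have idW : forall y x, W x -> W (bracket y x).
  apply: (ideal_generated linW) => i _ [a [h [b [nE nF ->]]]].
  rewrite !linearDr; split.
  - have [h' [b' [nb ->]]] := nested_opposite wF EF i nF.
    exists (bracket (E i) a - alpha i h *: E i), h', b'; split=> //.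
      rewrite addrC -scaleNr; apply: nested_lin; [exact: nested_gen|exact: nested_bracket].
    by rewrite (bracketC (E i) (vsval h)) ghE addrA.
  - have [h' [a' [na ->]]] := nested_opposite wE FE i nE.
    exists a', h', (alpha i h *: F i + bracket (F i) b); split=> //.
      by apply: nested_lin; [exact: nested_gen|exact: nested_bracket].
    by rewrite (bracketC (F i) (vsval h)) ghF scaleNr opprK addrA (addrC a').
  exists (bracket (vsval (gH g i)) a), 0, (bracket (vsval (gH g i)) b).
  rewrite sla_hC linear0; split=> //.
    exact: nested_cartan wE _ _ nE.
  exact: nested_cartan wF _ _ nF.
by move: x; apply: generated => // x y _ Wy; apply: idW.
Qed.

Section Grading.
(** [rho] defines the principal grading; the positive degrees are in the first part
    of the triangular decomposition, by comparison of eigenvalues. *)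
Variable rho : subvs_of (sla_h g).
Hypothesis rhoP : forall i, alpha i rho = 1.

Lemma rho_eigen_prod (c : K) x : bracket (vsval rho) x = c *: x ->
  forall s : seq nat, foldr (fun m u => bracket (vsval rho) u + m%:R *: u) x s
    = (\prod_(m <- s) (c + m%:R)) *: x.
Proof.
move=> ex; elim=> [|m s IH] /=; first by rewrite big_nil scale1r.
by rewrite IH big_cons linearZr_LR /= ex !scalerA -scalerDl mulrDl [c * _]mulrC.
Qed.

Lemma nested_F_graded b : nested F b -> exists l : seq (nat * g),
  b = \sum_(q <- l) q.2 /\
  forall q, q \in l -> bracket (vsval rho) q.2 = - q.1%:R *: q.2.
Proof.
elim=> [|a u v _ [lu [-> gu]] _ [lv [-> gv]]|i|i u nu [l [-> gl]]].
- by exists [::]; rewrite big_nil.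
- exists ([seq (q.1, a *: q.2) | q <- lu] ++ lv); rewrite big_cat big_map scaler_sumr.
  split=> // q; rewrite mem_cat => /orP[/mapP[q' ql ->]|]; last exact: gv.
  by rewrite /= linearZr_LR /= gu // !scalerA mulrC.
- exists [:: (1%N, F i)]; rewrite big_seq1; split=> // q; rewrite inE => /eqP-> /=.
  by rewrite ghF rhoP.
exists [seq (q.1.+1, bracket (F i) q.2) | q <- l]; rewrite big_map linear_sumr.
split=> // _ /mapP[q ql ->] /=.
rewrite bracket_derivation ghF rhoP gl // linearZl_LR linearZr_LR /= -scalerDl.
by rewrite -addn1 natrD opprD addrC.
Qed.

Lemma positive_degree_nested m x :
  bracket (vsval rho) x = m.+1%:R *: x -> nested E x.
Proof.
move=> ex; have [a [h [b [nE nF xE]]]] := triangular x.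
have [l [bE gl]] := nested_F_graded nF.
pose T s u := foldr (fun m u => bracket (vsval rho) u + m%:R *: u) u s.
have TD s u v : T s (u + v) = T s u + T s v.
  by elim: s => //= q s ->; rewrite linearDr scalerDr addrACA.
have Ta s : nested E (T s a).
  elim: s => //= q s IH; apply: (linear_setD (nested_linear E)).
    exact: nested_cartan (fun h i => ghE h i) _ _ IH.
  exact: (linear_setZ (nested_linear E)).
(* The product over s of (ad rho + m) kills the parts of degree at most 0 of x,
   and multiplies x by a positive integer. *)
pose s := 0%N :: [seq q.1 | q <- l].
have Th : T s (vsval h) = 0.
  rewrite /T (@rho_eigen_prod 0); last by rewrite sla_hC scale0r.
  by rewrite big_cons addr0 mul0r scale0r.
have Tb : T s b = 0.
  have T0 s' : T s' 0 = 0 by elim: s' => //= q s' ->; rewrite linear0r scaler0 addr0.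
  rewrite bE big_seq; elim/big_rec: _ => [|q u ql Tu]; first exact: T0.
  rewrite TD Tu addr0 /T (rho_eigen_prod (gl q ql)).
  rewrite big_cons (big_rem q.1) ?map_f //= addNr mul0r mulr0 scale0r //.
have : T s x = T s a by rewrite xE !TD Th Tb !addr0.
rewrite {1}/T (rho_eigen_prod ex).
set c := \prod_(_ <- _) _; have c0 : c != 0.
  rewrite /c; elim/big_rec: _ => [|q u _ u0]; first exact: oner_neq0.
  by rewrite mulf_neq0 // -natrD pnatr_eq0.
move=> xT; rewrite -(scalerK c0 x) xT; exact: (linear_setZ (nested_linear E)).
Qed.

End Grading.

Lemma gE_n_plus i : n_plus (E i).
Proof.
move=> U HU; apply: (HU (alpha i)); last by move=> h; rewrite ghE.
have [isroot _ _] := sroot_simple g; split=> //.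
exists (fun j => (j == i) : nat); rewrite (bigD1 i) //= eqxx big1 ?addr0 // => j.
by move=> /negPf->.
Qed.

(** A positive root takes a positive value on [rho], so its root space consists of
    iterated brackets of the generators [E i]. *)
Lemma n_plus_act (V : lie_module g) (v : V) : (forall i, Defs.act (E i) v = 0) ->
  forall x, n_plus x -> Defs.act x v = 0.
Proof.
move=> Ev; have [U UP] : exists U : {vspace g}, forall x, x \in U <-> Defs.act x v = 0.
  apply: linear_set_vspace => [|a u w u0 w0]; first by rewrite linear0l.
  by rewrite linearPl u0 w0 scaler0 addr0.
move=> x npx; apply/UP/npx => beta [[b0 _] [m betaE]] y ry; apply/UP.
have [d dual] := dual_roots g; pose rho := \sum_j d j.
have rhoP i : alpha i rho = 1.
  rewrite linear_sum (bigD1 i) //= dual eqxx big1 ?addr0 // => j /negPf.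
  by rewrite dual eq_sym => ->.
have ny : nested E y.
  apply: (positive_degree_nested rhoP (m := (\sum_i m i).-1)).
  rewrite ry prednK.
    congr (_ *: _); rewrite betaE sum_lfunE natr_sum; apply: eq_bigr => i _.
    by rewrite -scaler_nat scale_lfunE rhoP; exact: mulr1.
  rewrite lt0n; apply: contra b0; rewrite sum_nat_eq0 => /forallP m0.
  by rewrite betaE big1 // => i _; rewrite (eqP (m0 i)).
elim: ny => [|a u w _ u0 _ w0|i|i u _ u0]; rewrite ?linear0l ?Ev //.
  by rewrite linearPl u0 w0 scaler0 addr0.
by rewrite act_bracket u0 Ev !linear0r subrr.
Qed.

End Triangular.

(** * Pairing arrangements with the Shapovalov forms *)

Section Words.
Variables (K : numFieldType) (r : nat) (g : simple_lie_algebra K r).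
Variables (n k : nat) (Lam : 'I_n -> hweight g) (V : forall s, hw_irrep (Lam s)).
Variable c : 'I_k -> 'I_r.
Implicit Types (w : seq 'I_k) (W : {ffun 'I_n -> seq 'I_k}) (L : seq 'I_k).
Local Notation E := (gE g).
Local Notation F := (gF g).
Local Notation alpha := (sroot g).

Definition word s w : V s :=
  foldr (fun b v => Defs.act (F (c b)) v) (hwv (V s)) w.

Definition low_weight s w (h : subvs_of (sla_h g)) : K :=
  (Lam s h : K) - \sum_(x <- w) (alpha (c x) h : K).

Lemma act_comm (M : lie_module g) x y (v : M) :
  Defs.act x (Defs.act y v) = Defs.act (bracket x y) v + Defs.act y (Defs.act x v).
Proof. by rewrite act_bracket subrK. Qed.

Lemma act_word h s w : Defs.act (vsval h) (word s w) = low_weight s w h *: word s w.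
Proof.
rewrite /low_weight; elim: w => [|b w IH] /=.
  by rewrite big_nil subr0; have [_ ->] := hwv_sing (V s).
rewrite act_comm ghF linearZl_LR IH linearZr_LR /= -scalerDl big_cons.
by congr (_ *: _); rewrite opprD addrCA.
Qed.

Lemma raise_hwv i s : Defs.act (E i) (hwv (V s)) = 0.
Proof. by have [-> //] := hwv_sing (V s); apply: gE_n_plus. Qed.

(** [E i] commutes with [F j] up to the coroot [H i], so it removes each letter of
    color [i] in turn, with the weight of the letters on its right. *)
Lemma raise_word i s w : uniq w -> Defs.act (E i) (word s w) =
  \sum_(b <- w | c b == i) low_weight s (after b w) (gH g i) *: word s (rem b w).
Proof.
elim: w => [|a w IH] /=; first by rewrite big_nil raise_hwv.
move=> /andP[aw uw]; rewrite act_comm gEF IH // linear_sumr big_cons eqxx.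
have -> : after a (a :: w) = w by rewrite /after /= eqxx drop0.
have -> : \sum_(b <- w | c b == i) low_weight s (after b (a :: w)) (gH g i)
       *: word s (if a == b then w else a :: rem b w)
   = \sum_(b <- w | c b == i)
       Defs.act (F (c a)) (low_weight s (after b w) (gH g i) *: word s (rem b w)).
  rewrite big_seq_cond [in RHS]big_seq_cond; apply: eq_bigr => b /andP[bw _].
  have /negPf ab : a != b by apply: contra aw => /eqP->.
  by rewrite /after /= ab linearZr_LR.
rewrite [c a == i]eq_sym; case: eqP => _; last by rewrite linear0l add0r.
by rewrite act_word.
Qed.

Section Pick.
Variables (z : 'I_n -> K) (u : 'rV[K]_k).
Hypotheses (u_inj : injective (u 0)) (u_z : forall i s, u 0 i != z s).

Definition chain_prod W : K := \prod_s omega_chain u (z s) (W s).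

(** The terms of the factor by which [E (c b)] removes [b].  Over all the sites and
    all the other labels they add up to minus the derivative of ln Phi in the
    variable of [b], up to normalization. *)
Definition raise_site s b : K := (Lam s (gH g (c b)) : K) / (u 0 b - z s).
Definition raise_edge b x : K := - (alpha (c x) (gH g (c b)) : K) / (u 0 b - u 0 x).

(** The coefficients of [E i] on a word and the insertion of a label in a chain
    combine into a factor that is independent of the order of the word. *)
Lemma sum_pick_chain (M : lmodType K) s L
    (G : 'I_k -> {ffun 'I_n -> seq 'I_k} -> M) : uniq L ->
  \sum_(W <- arrangements n L) \sum_(b <- W s)
     (chain_prod W * low_weight s (after b (W s)) (gH g (c b))) *: G b (delete b W)
  = \sum_(b <- L) \sum_(W <- arrangements n (rem b L))
     (chain_prod W * (raise_site s b + \sum_(x <- W s) raise_edge b x)) *: G b W.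
Proof.
move=> uL; rewrite (sum_arrs_pick s (fun W b => (chain_prod W *
  low_weight s (after b (W s)) (gH g (c b))) *: G b (delete b W)) uL).
apply: eq_bigr => b _; rewrite !big_seq; apply: eq_bigr => W WL.
have uL' : uniq (rem b L) by rewrite rem_uniq.
have bW s' : b \notin W s'.
  by apply/negP => /(arrs_sub WL); rewrite mem_rem_uniq // !inE eqxx.
have ub : uniq (b :: W s) by rewrite /= bW (arrs_uniq _ uL' WL).
rewrite /raise_site /raise_edge.
rewrite [in RHS]/chain_prod [in RHS](bigD1 s) //= mulrAC.
rewrite -(sum_insert u_inj (u_z^~ s) _ (fun x => - alpha (c x) (gH g (c b)) : K) ub).
rewrite big_distrl scaler_suml /=; apply: eq_big_nat => p /andP[_ ps].
have -> : delete b (insert_at s p b W) = W.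
  apply/ffunP => s'; rewrite !ffunE; case: eqP => [->|_]; last exact: rem_id.
  by rewrite rem_insert.
congr (_ *: _); rewrite /chain_prod (bigD1 s) //= !ffunE eqxx -!mulrA; congr (_ * _).
rewrite mulrC; congr (_ * _).
  rewrite /low_weight /after index_insert // -cat_rcons drop_size_cat ?sumrN //.
  by rewrite size_rcons size_takel.
by apply: eq_bigr => s' /negPf ne; rewrite ffunE ne.
Qed.

End Pick.

End Words.

Section Pairing.
Variables (K : numFieldType) (r : nat) (g : simple_lie_algebra K r).
Variables (tau : {linear g -> g}) (tauP : chevalley_anti_involution tau).
Variables (n k : nat) (Lam : 'I_n -> hweight g) (V : forall s, hw_irrep (Lam s)).
Variable SV : forall s, {bilinear V s -> V s -> K | *%R & *%R}.
Hypothesis SVP : forall s, shapovalov_form tau (SV s).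
Variable c : 'I_k -> 'I_r.
Variables (z : 'I_n -> K) (u : 'rV[K]_k).
Hypotheses (u_inj : injective (u 0)) (u_z : forall i s, u 0 i != z s).
Implicit Types (w : seq 'I_k) (W : {ffun 'I_n -> seq 'I_k}) (L : seq 'I_k).

Definition word_form s w w' : K := SV s (word V c s w) (word V c s w').

Lemma word_form_nil s w : word_form s [::] w = (w == [::])%:R.
Proof.
have [sym S1 inv] := SVP s; have [_ _ tauG] := tauP.
case: w => [|b w]; first exact: S1.
by rewrite /word_form sym /= inv; have [_ -> _] := tauG (c b); rewrite raise_hwv linear0r.
Qed.

Lemma word_form_cons s a w w' : uniq w' -> word_form s (a :: w) w' =
  \sum_(b <- w' | c b == c a)
     low_weight Lam c s (after b w') (gH g (c b)) * word_form s w (rem b w').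
Proof.
have [sym S1 inv] := SVP s; have [_ _ tauG] := tauP => uw'.
rewrite /word_form /= inv; have [_ -> _] := tauG (c a).
rewrite raise_word // linear_sumr; apply: eq_bigr => b /eqP ->.
by rewrite linearZr_LR.
Qed.

Definition colors_match W W0 := [forall s, map c (W s) == map c (W0 s)].

Local Notation ladders W :=
  (\prod_s ladder (raise_site Lam c z u s) (raise_edge g c u) (W s)).

(** By induction on [W0]: the first letter of a word of [W0] is moved to the
    other side of the form.  The factor that appears depends on the labels that
    remain in the same word, but not on their order; this is why a weight [h]
    that depends on the contents of the words is carried along. *)
Lemma pairing L W0 (h : {ffun 'I_n -> seq 'I_k} -> K) : uniq L ->
  (forall W W', (forall s, perm_eq (W s) (W' s)) -> h W = h W') ->
  \sum_(W <- arrangements n L) h W * (chain_prod z u W * \prod_s word_form s (W0 s) (W s))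
  = \sum_(W <- arrangements n L | colors_match W W0) h W * ladders W.
Proof.
have [m] := ubnP (\sum_s size (W0 s)).
elim: m => // m IH in L W0 h *; rewrite ltnS => W0m uL hP.
have [/forallP W0nil|/forallPn[s W0s]] := boolP [forall s, W0 s == [::]].
  rewrite [RHS]big_mkcond; apply: eq_bigr => W _.
  have [/forallP Wm|/forallPn[s Ws]] := boolP (colors_match W W0).
    have Wnil s : W s = [::] by move: (Wm s); rewrite (eqP (W0nil s)); case: (W s).
    rewrite /chain_prod !big1 ?mulr1 // => s _; rewrite ?Wnil //.
    by rewrite (eqP (W0nil s)) word_form_nil.
  rewrite [X in _ * (_ * X)](bigD1 s) //= (eqP (W0nil s)) word_form_nil.
  by move: Ws; rewrite (eqP (W0nil s)); case: (W s) => // b w _; rewrite mul0r !mulr0.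
case W0sE: (W0 s) W0s => [//|a w0] _.
pose W0' := [ffun s' => if s' == s then w0 else W0 s'] : {ffun 'I_n -> seq 'I_k}.
have W0'm : (\sum_s' size (W0' s') < m)%N.
  apply: leq_trans W0m; rewrite (bigD1 s) //= [X in (_ < X)%N](bigD1 s) //=.
  rewrite ffunE eqxx W0sE /= addSn ltnS leq_add2l leq_sum // => s' /negPf ne.
  by rewrite ffunE ne.
pose G b W := (c b == c a)%:R
  * (h (insert_at s 0 b W) * \prod_s' word_form s' (W0' s') (W s')) : K^o.
have h_pick W b : W \in arrangements n L -> b \in W s -> h (insert_at s 0 b (delete b W)) = h W.
  move=> WL bs; apply: hP => s'; rewrite !ffunE take0 drop0 /=; case: eqP => [->|ne].
    by rewrite perm_sym perm_to_rem.
  rewrite rem_id //; apply/negP => bs'; apply: ne.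
  exact: arrs_disjoint uL WL bs' bs.
transitivity (\sum_(W <- arrangements n L) \sum_(b <- W s)
   (chain_prod z u W * low_weight Lam c s (after b (W s)) (gH g (c b))) *: G b (delete b W)).
  rewrite !big_seq; apply: eq_bigr => W WL.
  have uWs := arrs_uniq s uL WL.
  rewrite [X in _ * (_ * X)](bigD1 s) //= W0sE word_form_cons // big_mkcond.
  rewrite !(big_distrl, big_distrr) /= !big_seq; apply: eq_bigr => b bs.
  rewrite /G h_pick // [\prod_s' _ in RHS](bigD1 s) //= !ffunE eqxx.
  rewrite [\prod_(s' | s' != s) _ in RHS](eq_bigr (fun s' => word_form s' (W0 s') (W s'))).
    by case: eqP => _; rewrite /GRing.scale /= ?mul0r ?mulr0 ?mulr0 //; ring.
  move=> s' ne; rewrite !ffunE (negPf ne) rem_id //; apply/negP => bs'.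
  by move/eqP: ne; apply; apply: arrs_disjoint uL WL bs' bs.
rewrite sum_pick_chain //.
transitivity (\sum_(b <- L)
   \sum_(W <- arrangements n (rem b L) | (c b == c a) && colors_match W W0')
     h (insert_at s 0 b W) * ladders (insert_at s 0 b W)).
  apply: eq_bigr => b _.
  case: (c b =P c a) => [cba|ncba] /=; last first.
    rewrite [RHS]big_pred0_eq big1 // => W _.
    by rewrite /G; case: eqP => //; rewrite mul0r scaler0.
  pose h' W := h (insert_at s 0 b W)
     * (raise_site Lam c z u s b + \sum_(x <- W s) raise_edge g c u b x).
  transitivity (\sum_(W <- arrangements n (rem b L))
      h' W * (chain_prod z u W * \prod_s' word_form s' (W0' s') (W s'))).
    apply: eq_bigr => W _; rewrite /G cba eqxx mul1r /h' /GRing.scale /=; ring.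
  rewrite (IH _ W0' h' W0'm) ?rem_uniq //.
    apply: eq_bigr => W _; rewrite /h' [in RHS](bigD1 s) //= [in LHS](bigD1 s) //=.
    rewrite ffunE eqxx take0 drop0 /= -!mulrA; congr (_ * (_ * (_ * _))).
    by apply: eq_bigr => s' /negPf ne; rewrite ffunE ne.
  move=> W W' WW'; rewrite /h' (perm_big _ (WW' s)); congr (_ * _).
  apply: hP => s'; rewrite !ffunE !take0 !drop0 /=; case: eqP => _ //.
  by rewrite perm_cons.
transitivity (\sum_(W <- arrangements n L) \sum_(b <- W s)
    ((index b (W s) == 0%N) && colors_match W W0)%:R * (h W * ladders W)); last first.
  rewrite [RHS]big_mkcond !big_seq; apply: eq_bigr => W WL.
  case: ifP => Wm; last by rewrite big1 // => b _; rewrite andbF mul0r.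
  have uWs := arrs_uniq s uL WL.
  have /forallP/(_ s) := Wm; rewrite W0sE; case WsE: (W s) uWs => [//|b w] /andP[bw _] _.
  rewrite big_cons /= eqxx mul1r [X in _ + X]big1_seq ?addr0 // => x /= xw.
  by case: (b =P x) => [bx|_]; rewrite ?mul0r //; rewrite bx xw in bw.
rewrite (sum_arrs_pick s (fun W b => ((index b (W s) == 0%N) && colors_match W W0)%:R
   * (h W * ladders W)) uL).
apply: eq_bigr => b _; rewrite big_mkcond !big_seq; apply: eq_bigr => W WL.
have bW s' : b \notin W s'.
  by apply/negP => /(arrs_sub WL); rewrite mem_rem_uniq // !inE eqxx.
rewrite big_nat_recl // [X in _ + X]big1_seq ?addr0; last first.
  move=> p; rewrite mem_index_iota /= => ps.
  by rewrite ffunE eqxx index_insert // mul0r.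
rewrite ffunE eqxx index_insert // eqxx /=.
suff -> : colors_match (insert_at s 0 b W) W0 = (c b == c a) && colors_match W W0'.
  by case: ifP; rewrite ?mul1r ?mul0r.
apply/forallP/andP => [m0|[/eqP cba /forallP m0] s'].
  split; first by have := m0 s; rewrite ffunE eqxx take0 /= W0sE => /eqP[-> _].
  apply/forallP => s'; have := m0 s'; rewrite !ffunE; case: (s' =P s) => // ->.
  by rewrite take0 drop0 W0sE /= => /eqP[_ ->].
have := m0 s'; rewrite !ffunE; case: (s' =P s) => // ->.
by rewrite take0 drop0 W0sE /= cba => /eqP->.
Qed.

End Pairing.

(** * The weight function as a sum over arrangements *)

Lemma count_blocks (T : Type) (P : pred T) (d : nat -> nat) (e : seq T) m :
  (\sum_(s < m) count P (take (d s) (drop (\sum_(s' < s) d s') e))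
   = count P (take (\sum_(s < m) d s) e))%N.
Proof.
elim: m => [|m IH]; first by rewrite !big_ord0 take0.
by rewrite !big_ord_recr /= IH takeD count_cat.
Qed.

Section WeightFunctionSum.
Variables (K : numFieldType) (r : nat) (g : simple_lie_algebra K r).
Variables (n k : nat) (Lam : 'I_n -> hweight g) (V : forall s, hw_irrep (Lam s)).
Variable T : tensor_module V.
Variables (kk : 'I_r -> nat) (c : 'I_k -> 'I_r).
Hypothesis k_sum : k = (\sum_i kk i)%N.
Hypothesis c_kk : forall i, #|[set j | c j == i]%SET| = kk i.
Variables (z : 'I_n -> K) (t : 'rV[K]_k).
Implicit Types (W : {ffun 'I_n -> seq 'I_k}) (I : words r n k).
Local Notation full := (arrangements n (enum 'I_k)).

Definition pure_word W : T := pure T (fun s => word V c s (W s)).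

(** The arrangement of the labels in increasing order, with the word lengths of
    [I]: the blocks of a permutation are its relabellings. *)
Definition standard I : {ffun 'I_n -> seq 'I_k} :=
  [ffun s => take (size (I s))
     (drop (\sum_(s' < n | (s' < s)%N) size (I s')) (enum 'I_k))].

Lemma perm_block_standard I (sigma : 'S_k) s :
  perm_block I sigma s = relabel sigma (standard I) s.
Proof. by rewrite !ffunE map_take map_drop. Qed.

Lemma in_P_size I : in_P kk I -> (\sum_s size (I s) = k)%N.
Proof.
move=> /forallP kkI; rewrite [RHS]k_sum.
under [RHS]eq_bigr => i _ do rewrite -(eqP (kkI i)).
rewrite exchange_big; apply: eq_bigr => s _ /=.
elim: (I s : seq _) => [|a w IH] /=; first by rewrite big1.
by rewrite big_split -IH (bigD1 a) //= eqxx big1 // => i; rewrite eq_sym => /negPf->.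
Qed.

Lemma standard_full I : in_P kk I -> standard I \in full.
Proof.
move=> /in_P_size Ik; apply/arrsP => P.
pose d j := if insub j is Some s then size (I s) else 0%N.
have dE (s : 'I_n) : d s = size (I s) by rewrite /d valK.
rewrite -[enum 'I_k in RHS](take_oversize (n := \sum_(s < n) d s)); last first.
  rewrite size_enum_ord -[leqLHS]Ik leq_eqVlt; apply/orP; left; apply/eqP.
  by apply: eq_bigr => s _; rewrite dE.
rewrite -count_blocks; apply: eq_bigr => s _; rewrite ffunE dE.
congr (count _ (take _ (drop _ _))); rewrite (big_ord_widen n d) 1?ltnW //.
by apply: eq_bigr => s' _; rewrite dE.
Qed.

Lemma size_standard I s : in_P kk I -> size (standard I s) = size (I s).
Proof.
move=> /in_P_size Ik; rewrite ffunE size_takel // size_drop size_enum_ord.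
have le : (\sum_(s' < n | (s' < s)%N) size (I s') + size (I s) <= k)%N.
  rewrite -[leqRHS]Ik [leqRHS](bigID (fun s' : 'I_n => (s' < s)%N)) /= leq_add2l.
  by rewrite (bigD1 s) ?ltnn //= leq_addr.
by rewrite leq_subRL // (leq_trans (leq_addr _ _) le).
Qed.

Definition color_word W : words r n k := [ffun s => insub_bseq k (map c (W s))].

Lemma color_wordE W s : W \in full -> color_word W s = map c (W s) :> seq _.
Proof.
move=> WA; rewrite ffunE insubdK // -topredE /= size_map.
rewrite -[k in (_ <= k)%N]size_enum_ord uniq_leq_size ?(arrs_uniq s (enum_uniq _) WA) //.
by move=> x _; rewrite mem_enum.
Qed.

Lemma in_P_color_word W : W \in full -> in_P kk (color_word W).
Proof.
move=> WA; apply/forallP => i; apply/eqP; rewrite -c_kk.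
under eq_bigr do rewrite (color_wordE _ WA) count_map.
rewrite (arrsP _ _ WA) -sum1_card -sum1_count big_enum_cond.
by apply: eq_bigl => x; rewrite inE.
Qed.

(** A pair of a sequence [I] in [P(kk, n)] and a permutation in [Sigma(I)] amounts
    to an arrangement of all the labels, of which [I] is the sequence of colors. *)
Lemma weight_function_arrs :
  weight_function T kk c z t = \sum_(W <- full) chain_prod z t W *: pure_word W.
Proof.
rewrite /weight_function.
transitivity (\sum_(I : words r n k | in_P kk I)
    \sum_(W <- full | [forall s, map c (W s) == I s])
      chain_prod z t W *: pure T (F_word V I)).
  apply: eq_bigr => I PI.
  rewrite -(sum_relabel (fun W => chain_prod z t W *: pure T (F_word V I))
    (standard_full PI)).
    apply: eq_big => [sigma|sigma _].
      by apply: eq_forallb => s; rewrite perm_block_standard.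
    by congr (_ *: _); apply: eq_bigr => s _; rewrite perm_block_standard.
  move=> W /forallP WI s; rewrite size_standard // -(eqP (WI s)).
  by rewrite size_map.
under eq_bigr do rewrite big_mkcond.
rewrite exchange_big !big_seq; apply: eq_bigr => W WA; rewrite -big_mkcondr /=.
rewrite (big_pred1 (color_word W)) => [|I].
  congr (_ *: pure T _); apply: functional_extensionality_dep => s.
  by rewrite /F_word color_wordE // /word foldr_map.
apply/andP/eqP => [[_ /forallP WI]|->].
  by apply/ffunP => s; apply/val_inj; rewrite /= color_wordE // -(eqP (WI s)).
split; first exact: in_P_color_word.
by apply/forallP => s; rewrite color_wordE.
Qed.

Lemma pure_sum (v : forall s, V s) s (I : Type) (l : seq I) (P : pred I)
    (a : I -> K) (x : I -> V s) :
  pure T (dfwith v s (\sum_(i <- l | P i) a i *: x i))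
  = \sum_(i <- l | P i) a i *: pure T (dfwith v s (x i)).
Proof.
have pm := @pure_multilinear _ _ _ _ T.
have p0 : pure T (dfwith v s 0) = 0.
  have := pm v s 1 0 0; rewrite !scale1r addr0 => /esym/eqP.
  by rewrite -subr_eq0 addrK => /eqP.
elim: l => [|i l IH]; first by rewrite !big_nil.
by rewrite !big_cons; case: ifP => // _; rewrite pm IH.
Qed.

Lemma weight_function_cartan (h : subvs_of (sla_h g)) :
  Defs.act (vsval h) (weight_function T kk c z t)
  = (\sum_s Lam s - \sum_i sroot g i *+ kk i : hweight g) h *: weight_function T kk c z t.
Proof.
rewrite weight_function_arrs linear_sumr scaler_sumr big_seq [RHS]big_seq.
apply: eq_bigr => W WA.
rewrite linearZr_LR /= !scalerA mulrC -scalerA; congr (_ *: _).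
rewrite /pure_word act_pure.
transitivity (\sum_s low_weight Lam c s (W s) h *: pure_word W).
  apply: eq_bigr => s _; rewrite act_word.
  have := pure_sum (fun s => word V c s (W s)) (s := s) [:: tt] xpredT
    (fun _ => low_weight Lam c s (W s) h) (fun _ => word V c s (W s)).
  rewrite !big_seq1 => ->; congr (_ *: pure T _).
  apply: functional_extensionality_dep => s'.
  by case: dfwithP.
rewrite -scaler_suml; congr (_ *: _); rewrite /low_weight sumrB.
rewrite add_lfunE opp_lfunE !sum_lfunE; congr (_ - _).
transitivity (\sum_(x <- content W) (sroot g (c x) h : K)).
  by rewrite big_flatten big_map big_enum.
rewrite (perm_big _ (full_content WA)) big_enum (partition_big c xpredT) //=.
apply: eq_bigr => i _; rewrite (eq_bigr (fun=> sroot g i h : K)) => [|j /eqP->//].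
rewrite -[in RHS]scaler_nat scale_lfunE scaler_nat sumr_const -c_kk; congr (_ *+ _).
by apply: eq_card => j; rewrite !inE.
Qed.

Hypotheses (t_inj : injective (t 0)) (t_z : forall i s, t 0 i != z s).

(** The coefficient of each vector obtained by removing a label [b] is, up to
    normalization, the derivative of ln Phi in the variable of [b]. *)
Lemma weight_function_raise i : critical Lam c z t ->
  Defs.act (gE g i) (weight_function T kk c z t) = 0.
Proof.
move=> crit; rewrite weight_function_arrs linear_sumr.
pose L := enum 'I_k; have uL : uniq L := enum_uniq _.
pose G b W := (c b == i)%:R *: pure_word W.
transitivity (\sum_s \sum_(W <- full) \sum_(b <- W s)
  (chain_prod z t W * low_weight Lam c s (after b (W s)) (gH g (c b))) *: G b (delete b W)).
  rewrite exchange_big !big_seq; apply: eq_bigr => W WA.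
  rewrite linearZr_LR /= act_pure scaler_sumr; apply: eq_bigr => s _.
  rewrite raise_word ?(arrs_uniq s uL WA) // pure_sum scaler_sumr big_mkcond !big_seq.
  apply: eq_bigr => b bs; rewrite /G.
  case: eqP => [<-|_]; last by rewrite scale0r scaler0.
  rewrite scale1r scalerA; congr (_ *: pure T _).
  apply: functional_extensionality_dep => s'.
  case: dfwithP => [|s'' ne]; first by rewrite ffunE.
  rewrite ffunE rem_id //; apply/negP => bs'.
  by move/eqP: ne; apply; apply: arrs_disjoint uL WA bs bs'.
under eq_bigr do rewrite sum_pick_chain //.
rewrite exchange_big big1 // => b _; rewrite exchange_big big_seq big1 // => W WL.
rewrite -scaler_suml -big_distrr /= big_split /=.
suff -> : \sum_s raise_site Lam c z t s b
    + \sum_s \sum_(x <- W s) raise_edge g c t b x = 0.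
  by rewrite mulr0 scale0r.
have -> : \sum_s \sum_(x <- W s) raise_edge g c t b x
    = \sum_(x | x != b) raise_edge g c t b x.
  transitivity (\sum_(x <- content W) raise_edge g c t b x).
    by rewrite big_flatten big_map big_enum.
  rewrite (perm_big (rem b L)) /=; last first.
    by apply/seq.permP => P; rewrite count_content (arrsP _ _ WL).
  by rewrite rem_filter // big_filter big_enum_cond; apply: eq_bigl => x; rewrite inE.
set m := wform (sroot g (c b)) (sroot g (c b)) / 2.
have m0 : m != 0 by rewrite mulf_neq0 ?sroot_anisotropic // invr_eq0 pnatr_eq0.
apply: (mulfI m0); rewrite mulr0 mulrDr !big_distrr /=.
apply/eqP; rewrite -oppr_eq0 opprD -[X in _ == X](crit b) /dlog_master; apply/eqP.
congr (_ + _).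
  by congr (- _); apply: eq_bigr => s _; rewrite /raise_site mulrA coroot_wform.
rewrite -sumrN; apply: eq_bigr => x _; rewrite /raise_edge !mulNr mulrN opprK.
by rewrite mulrA coroot_wform.
Qed.

Lemma weight_function_sing : critical Lam c z t ->
  sing (\sum_s Lam s - \sum_i sroot g i *+ kk i) (weight_function T kk c z t).
Proof.
move=> crit; split=> [x|h]; last exact: weight_function_cartan.
by apply: n_plus_act => i; apply: weight_function_raise.
Qed.

End WeightFunctionSum.

(** * Norms of Bethe vectors *)

Section Hessian.
Variables (K : numFieldType) (r : nat) (g : simple_lie_algebra K r).
Variables (n k : nat) (Lam : 'I_n -> hweight g) (c : 'I_k -> 'I_r).
Variable z : 'I_n -> K.
Local Notation alpha i := (sroot g (c i)).
Implicit Types t u : 'rV[K]_k.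

(** The Hessian of ln Phi, polarized in the two points; the fractions with equal
    labels are zero by the convention on inverses. *)
Definition gram_mx t u : 'M[K]_k := \matrix_(i, j)
  ((i == j)%:R * (\sum_s wform (alpha i) (Lam s) / (u 0 i - z s) / (t 0 i - z s)
     - \sum_l wform (alpha i) (alpha l) / (u 0 i - u 0 l) / (t 0 i - t 0 l))
   + wform (alpha i) (alpha j) / (u 0 i - u 0 j) / (t 0 i - t 0 j)).

(** Each fraction satisfies
    ((t_i - t_j) - (u_i - u_j)) / ((u_i - u_j) (t_i - t_j))
    = 1/(u_i - u_j) - 1/(t_i - t_j). *)
Lemma gram_mx_sub t u i : off_diagonal z t -> off_diagonal z u ->
  \sum_j gram_mx t u i j * (t 0 j - u 0 j)
  = dlog_master Lam c z i t - dlog_master Lam c z i u.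
Proof.
move=> [ti tz] [ui uz].
under eq_bigr => j _ do rewrite mxE mulrDl -[_%:R * _ * _]mulrA.
have delta (f : 'I_k -> K) : \sum_j (i == j)%:R * f j = f i.
  rewrite (bigD1 i) //= eqxx mul1r big1 ?addr0 // => j.
  by rewrite eq_sym => /negPf->; rewrite mul0r.
rewrite big_split /= delta mulrBl !big_distrl /= -addrA [- _ + _]addrC -sumrB /dlog_master.
rewrite opprD opprK addrACA; congr (_ + _).
  rewrite addrC -sumrB; apply: eq_bigr => s _.
  have tn : t 0 i - z s != 0 by rewrite subr_eq0.
  have un : u 0 i - z s != 0 by rewrite subr_eq0.
  by field; rewrite tn un.
rewrite -sumrB (bigD1 i) //= subrr add0r; apply: eq_bigr => j ji.
have tn : t 0 i - t 0 j != 0 by rewrite subr_eq0 (inj_eq ti) eq_sym.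
have un : u 0 i - u 0 j != 0 by rewrite subr_eq0 (inj_eq ui) eq_sym.
by field; rewrite tn un.
Qed.

(** The kernel contains [t - u], by [gram_mx_sub]. *)
Lemma det_gram_mx t u : off_diagonal z t -> off_diagonal z u ->
  critical Lam c z t -> critical Lam c z u -> t != u -> \det (gram_mx t u) = 0.
Proof.
move=> ot ou ct cu tu; apply/eqP; rewrite -det_tr; apply/det0P; exists (t - u).
  by rewrite subr_eq0.
apply/rowP => i; rewrite !mxE.
under eq_bigr do rewrite [in X in _ * X]mxE [in X in X * _]mxE mxE mulrC.
by rewrite gram_mx_sub // ct cu subrr.
Qed.

Lemma is_derive_coord (t v : 'rV[K]_k) j :
  is_derive t v (fun x : 'rV[K]_k => x 0 j) (v 0 j).
Proof.
have @f : {linear 'rV[K]_k -> K}.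
  by exists (fun N : 'rV[K]_k => N 0 j); do 2![eexists]; do ?[constructor];
     rewrite ?mxE// => ? *; rewrite ?mxE//; move=> ?; rewrite !mxE.
have fc : continuous f by apply: coord_continuous.
have fd : differentiable f t by apply: linear_differentiable.
apply: DeriveDef; first exact: (diff_derivable (f := f)).
by rewrite (deriveE (f := f)) // diff_lin.
Qed.

Lemma is_derive_inv (f : 'rV[K]_k -> K) t v df : f t != 0 -> is_derive t v f df ->
  is_derive t v (fun x => (f x)^-1) (- df / f t ^+ 2).
Proof.
move=> f0 [dv <-]; apply: DeriveDef; first exact: derivableV.
by rewrite deriveV // /GRing.scale /= mulrC mulrN -mulNr.
Qed.

Lemma hessian_gram_mx t : off_diagonal z t -> hessian_log_master Lam c z t = gram_mx t t.
Proof.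
move=> [ti tz]; apply/matrixP => i j; rewrite !mxE.
pose v : 'rV[K]_k := delta_mx 0 j.
have vE l : v 0 l = (l == j)%:R by rewrite mxE eqxx.
pose hs s := wform (alpha i) (Lam s) \*: (fun x : 'rV[K]_k => (x 0 i - z s)^-1).
pose hl l : 'rV[K]_k -> K := if l == i then cst 0
  else wform (alpha i) (alpha l) \*: (fun x : 'rV[K]_k => (x 0 i - x 0 l)^-1).
have -> : dlog_master Lam c z i = - (\sum_s hs s) + \sum_l hl l.
  apply: funext => x; rewrite /dlog_master !fctE; congr (- _ + _).
    by rewrite fct_sumE.
  rewrite fct_sumE big_mkcond; apply: eq_bigr => l _ /=.
  by rewrite /hl; case: eqP.
have ds s : is_derive t v (hs s)
    (wform (alpha i) (Lam s) *: (- (v 0 i) / (t 0 i - z s) ^+ 2)).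
  apply: is_deriveZ; apply: is_derive_inv; first by rewrite subr_eq0.
  have := is_deriveB (is_derive_coord t v i) (is_derive_cst (z s) t v).
  by rewrite subr0.
have dl l : is_derive t v (hl l)
    (wform (alpha i) (alpha l) *: (- (v 0 i - v 0 l) / (t 0 i - t 0 l) ^+ 2)).
  rewrite /hl; case: eqP => [->|/eqP li].
    by rewrite subrr oppr0 mul0r scaler0; apply: is_derive_cst.
  apply: is_deriveZ; apply: is_derive_inv.
    by rewrite subr_eq0 (inj_eq ti) eq_sym.
  exact: is_deriveB (is_derive_coord t v i) (is_derive_coord t v l).
have [_ ->] := is_deriveD (is_deriveN (is_derive_sum ds)) (is_derive_sum dl).
rewrite mulrBr -addrA !big_distrr -sumrN; congr (_ + _).
  by apply: eq_bigr => s _; rewrite /GRing.scale /= vE -[in RHS]mulrA -invfM -expr2; ring.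
have -> : wform (alpha i) (alpha j) / (t 0 i - t 0 j) / (t 0 i - t 0 j) =
   \sum_l (l == j)%:R * (wform (alpha i) (alpha l) / (t 0 i - t 0 l) / (t 0 i - t 0 l)).
  rewrite (bigD1 j) //= eqxx mul1r big1 ?addr0 // => l /negPf->.
  by rewrite mul0r.
rewrite addrC -sumrB; apply: eq_bigr => l _; rewrite /GRing.scale /= !vE.
by rewrite expr2 invfM; ring.
Qed.

End Hessian.

Section Norm.
Variables (K : numFieldType) (r : nat) (g : simple_lie_algebra K r).
Variables (tau : {linear g -> g}) (tauP : chevalley_anti_involution tau).
Variables (n k : nat) (Lam : 'I_n -> hweight g) (V : forall s, hw_irrep (Lam s)).
Variable T : tensor_module V.
Variable SV : forall s, {bilinear V s -> V s -> K | *%R & *%R}.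
Hypothesis SVP : forall s, shapovalov_form tau (SV s).
Variable S : {bilinear T -> T -> K | *%R & *%R}.
Hypothesis SP : tensor_form SV S.
Variables (kk : 'I_r -> nat) (c : 'I_k -> 'I_r).
Hypothesis k_sum : k = (\sum_i kk i)%N.
Hypothesis c_kk : forall i, #|[set j | c j == i]%SET| = kk i.
Variable z : 'I_n -> K.
Implicit Types t u : 'rV[K]_k.
Local Notation full := (arrangements n (enum 'I_k)).
Local Notation alpha i := (sroot g (c i)).
Local Notation color_preserving := [pred s : 'S_k | [forall i, c (s i) == c i]].

Lemma col_permE (s : 'S_k) u i : col_perm s u 0 i = u 0 (s i).
Proof. by rewrite mxE. Qed.

Lemma off_diagonal_col_perm (s : 'S_k) u :
  off_diagonal z u -> off_diagonal z (col_perm s u).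
Proof.
move=> [ui uz]; split=> [i j|i j]; rewrite !col_permE // => /ui; exact: perm_inj.
Qed.

Lemma critical_col_perm (s : 'S_k) u : color_preserving s ->
  critical Lam c z u -> critical Lam c z (col_perm s u).
Proof.
move=> /forallP cs crit i; rewrite -[RHS](crit (s i)) /dlog_master (eqP (cs i)).
congr (- _ + _); first by apply: eq_bigr => l _; rewrite col_permE.
rewrite [RHS](reindex_inj (@perm_inj _ s)) /=; apply: eq_big => j.
  by rewrite (inj_eq perm_inj).
by move=> _; rewrite !col_permE (eqP (cs j)).
Qed.

Lemma form_normalization_prod :
  form_normalization g kk = \prod_i (wform (alpha i) (alpha i) / 2).
Proof.
rewrite (partition_big c xpredT) //=; apply: eq_bigr => i _.
rewrite (eq_bigr (fun=> wform (sroot g i) (sroot g i) / 2)) => [|j /eqP->//].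
rewrite prodr_const -c_kk; congr (_ ^+ _); by apply: eq_card => j; rewrite !inE.
Qed.

Lemma form_normalization_neq0 : form_normalization g kk != 0.
Proof.
rewrite form_normalization_prod prodf_seq_neq0; apply/allP => i _ /=.
by rewrite mulf_neq0 ?sroot_anisotropic // invr_eq0 pnatr_eq0.
Qed.

(** The sum over pairs of arrangements is reduced by [pairing] to the pairs with
    the same colors, that is to an arrangement and a color-preserving permutation;
    for a given permutation the sum over arrangements is a determinant. *)
Lemma form_weight_functions t u : off_diagonal z t -> off_diagonal z u ->
  form_normalization g kk * S (weight_function T kk c z t) (weight_function T kk c z u)
  = \sum_(s : 'S_k | color_preserving s) \det (gram_mx Lam c z t (col_perm s u)).
Proof.
move=> [ti tz] [ui uz].
pose m i := wform (alpha i) (alpha i) / 2.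
pose ys (s : 'S_k) v x := m x * raise_site Lam c z u v (s x).
pose ps (s : 'S_k) x l := m x * raise_edge g c u (s x) (s l).
transitivity (\sum_(W <- full) \sum_(s : 'S_k | color_preserving s)
    chain_ladder t z (ys s) (ps s) W).
  rewrite !(weight_function_arrs _ k_sum c_kk) linear_sumlz big_distrr big_seq [RHS]big_seq.
  apply: eq_bigr => W0 W0A; rewrite linearZl_LR /= linear_sumr.
  transitivity (form_normalization g kk * (chain_prod z t W0 * \sum_(W <- full)
      1 * (chain_prod z u W * \prod_s word_form SV c s (W0 s) (W s)))).
    congr (_ * (_ * _)); apply: eq_bigr => W _.
    by rewrite mul1r linearZr_LR /= SP.
  rewrite (pairing tauP SVP c ui uz W0 (h := fun=> 1)) ?enum_uniq //.
  have szW W : colors_match c W W0 -> forall v, size (W v) = size (W0 v).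
    by move=> /forallP WW0 v; rewrite -(size_map c) (eqP (WW0 v)) size_map.
  rewrite -(sum_relabel (fun W => 1 * \prod_v ladder (raise_site Lam c z u v)
    (raise_edge g c u) (W v)) W0A szW).
  rewrite !big_distrr /=; apply: eq_big => s.
    apply/forallP/forallP => [cm i|cs v]; last first.
      by rewrite ffunE -map_comp; apply/eqP/eq_map => x /=; apply/eqP.
    have /existsP[v iv] : [exists v, i \in W0 v] by rewrite -(arrs_mem i W0A) mem_enum.
    have := cm v; rewrite ffunE -map_comp => /eqP/eq_in_map/(_ i iv) /= ->.
    exact: eqxx.
  move=> _; rewrite mul1r /chain_ladder big_split /= mulrCA; congr (_ * _).
  rewrite form_normalization_prod.
  transitivity ((\prod_v \prod_(x <- W0 v) m x) * \prod_v ladder (raise_site Lam c z u v)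
     (raise_edge g c u) (relabel s W0 v)).
    congr (_ * _); rewrite -[LHS]big_enum -(perm_big _ (full_content W0A)).
    by rewrite big_flatten big_map big_enum.
  rewrite -big_split; apply: eq_bigr => v _ /=.
  by rewrite ffunE ladder_map -ladder_scale.
rewrite exchange_big; apply: eq_bigr => s cs /=.
rewrite forest_expansion //; congr (\det _).
apply/matrixP => i j; rewrite [LHS]mxE [RHS]mxE.
have cse x : c (s x) = c x by apply/eqP; move: x; apply/forallP.
have psE x l : ps s x l
    = - (wform (alpha x) (alpha l) / (col_perm s u 0 x - col_perm s u 0 l)).
  by rewrite /ps /raise_edge !cse !col_permE mulNr mulrN mulrA coroot_wform.
have ysE v x : ys s v x = wform (alpha x) (Lam v) / (col_perm s u 0 x - z v).
  by rewrite /ys /raise_site cse col_permE mulrA coroot_wform.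
rewrite psE mulNr opprK; congr (_ * _ + _); rewrite -sumrN; congr (_ + _).
  by apply: eq_bigr => v _; rewrite ysE.
by apply: eq_bigr => l _; rewrite psE mulNr.
Qed.

Lemma bethe_orthogonal t u : off_diagonal z t -> off_diagonal z u ->
  critical Lam c z t -> critical Lam c z u ->
  (forall s : 'S_k, (forall i, c (s i) = c i) -> t <> col_perm s u) ->
  S (weight_function T kk c z t) (weight_function T kk c z u) = 0.
Proof.
move=> ot ou ct cu tu; apply: (mulfI form_normalization_neq0).
rewrite mulr0 form_weight_functions // big1 // => s cs.
apply: det_gram_mx => //; first exact: off_diagonal_col_perm.
  exact: critical_col_perm.
by apply/eqP/tu => i; apply/eqP; move: i; apply/forallP.
Qed.

Lemma bethe_norm t : off_diagonal z t -> critical Lam c z t ->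
  form_normalization g kk * S (weight_function T kk c z t) (weight_function T kk c z t)
  = \det (hessian_log_master Lam c z t).
Proof.
move=> ot ct; rewrite hessian_gram_mx // form_weight_functions // (bigD1 1%g) /=; last first.
  by apply/forallP => i; rewrite perm1.
rewrite col_perm1 big1 ?addr0 // => s /andP[cs s1].
apply: det_gram_mx => //; first exact: off_diagonal_col_perm.
  exact: critical_col_perm.
apply: contra s1 => /eqP ts; apply/eqP/permP => i; rewrite perm1.
by apply: ot.1; rewrite -col_permE -ts.
Qed.

End Norm.


(** * Bethe vectors of a simple Lie algebra *)

Lemma color_orbit_refl (r k : nat) (c : 'I_k -> 'I_r) (K : Type) (t : 'rV[K]_k) :
  color_orbit c t t.
Proof. by exists 1%g => [i|]; rewrite ?perm1 ?col_perm1. Qed.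

Lemma color_orbit_col_perm (r k : nat) (c : 'I_k -> 'I_r) (K : Type)
    (t : 'rV[K]_k) (s : 'S_k) :
  (forall i, c (s i) = c i) -> color_orbit c (col_perm s t) = color_orbit c t.
Proof.
move=> cs; apply/seteqP; split=> _ [s' /= cs' <-].
  by exists (s' * s)%g; [move=> i; rewrite permM cs cs' | rewrite col_permM].
exists (s' * s^-1)%g; last by rewrite -col_permM mulgKV.
by move=> i; rewrite permM -cs permKV cs'.
Qed.

Lemma orthogonal_lin_indep (K : fieldType) (M : lmodType K)
    (S : {bilinear M -> M -> K | *%R & *%R}) d (w : 'I_d -> M) :
  (forall i j, i != j -> S (w i) (w j) = 0) -> (forall i, S (w i) (w i) != 0) ->
  lin_indep w.
Proof.
move=> orth nz a aw0 j; apply/eqP.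
have := linear0l S (w j); rewrite -{}aw0 linear_sumlz (bigD1 j) //= big1 => [|i ij].
  by rewrite addr0 linearZl_LR /= => /eqP; rewrite mulf_eq0 (negPf (nz j)) orbF.
by rewrite linearZl_LR /= orth ?mulr0.
Qed.

Lemma lin_span_sing (K : numFieldType) (r : nat) (g : simple_lie_algebra K r)
    (M : lie_module g) (mu : hweight g) d (w : 'I_d -> M) :
  (forall i, sing mu (w i)) -> lin_span w `<=` sing mu.
Proof.
move=> ws _ [a ->]; split=> [x xn|y]; rewrite linear_sumr.
  by rewrite big1 // => i _; rewrite linearZr_LR /= (ws i).1 // scaler0.
rewrite scaler_sumr; apply: eq_bigr => i _.
by rewrite linearZr_LR /= (ws i).2 !scalerA mulrC.
Qed.

Theorem theorem5p2 (R : realType) (r : nat)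
  (g : simple_lie_algebra R[i] r)
  (tau : {linear g -> g}) (tauP : chevalley_anti_involution tau)
  (n : nat) (Lam : 'I_n -> hweight g)
  (V : forall s, hw_irrep (Lam s)) (T : tensor_module V)
  (SV : forall s, {bilinear V s -> V s -> R[i] | *%R & *%R})
  (SVP : forall s, shapovalov_form tau (SV s))
  (S : {bilinear T -> T -> R[i] | *%R & *%R})
  (SP : tensor_form SV S)
  (kk : 'I_r -> nat) (k : nat) (k_sum : k = (\sum_i kk i)%N)
  (c : 'I_k -> 'I_r) (cP : coloring c kk)
  (z : 'I_n -> R[i]) (z_inj : injective z) :
  [/\ forall t1 t2 : 'rV[R[i]]_k,
        off_diagonal z t1 -> off_diagonal z t2 ->
        isolated_critical Lam c z t1 -> isolated_critical Lam c z t2 ->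
        color_orbit c t1 `&` color_orbit c t2 = set0 ->
        S (weight_function T kk c z t1) (weight_function T kk c z t2) = 0,
      forall t1 : 'rV[R[i]]_k,
        off_diagonal z t1 ->
        isolated_critical Lam c z t1 ->
        form_normalization g kk
          * S (weight_function T kk c z t1) (weight_function T kk c z t1)
        = \det (hessian_log_master Lam c z t1)
    & forall (d : nat) (t : 'I_d -> 'rV[R[i]]_k),
        injective (fun i => color_orbit c (t i)) ->
        (forall i, nondegenerate_critical Lam c z (t i)) ->
        (forall i, off_diagonal z (t i)) ->
        let U := lin_span (fun i => weight_function T kk c z (t i)) in
        has_dim U d /\
        U `<=` sing (V := T) (\sum_s Lam s - \sum_i sroot g i *+ kk i)].
Proof.
have [_ c_kk] := cP.
have orth t1 t2 : off_diagonal z t1 -> off_diagonal z t2 ->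
    critical Lam c z t1 -> critical Lam c z t2 ->
    ~ color_orbit c t2 t1 ->
    S (weight_function T kk c z t1) (weight_function T kk c z t2) = 0.
  move=> o1 o2 c1 c2 t12; apply: (bethe_orthogonal tauP SVP SP k_sum c_kk) => // s cs t1E.
  by apply: t12; exists s.
have norm t1 (o1 : off_diagonal z t1) (c1 : critical Lam c z t1) :=
  bethe_norm tauP SVP SP k_sum c_kk o1 c1.
split=> [t1 t2 o1 o2 /isolatedS c1 /isolatedS c2 t12|t1 o1 /isolatedS c1|d t tO tc to].
- apply: orth => // t21; have : (color_orbit c t1 `&` color_orbit c t2) t1.
    by split=> //; apply: color_orbit_refl.
  by rewrite t12.
- exact: norm.
split; last first.
  apply: lin_span_sing => i.
  by apply: weight_function_sing => //; [apply: (to i).1|apply: (to i).2|apply: (tc i).1].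
exists (fun i => weight_function T kk c z (t i)); split=> //.
apply: (orthogonal_lin_indep (S := S)) => [i j ij|i].
  apply: orth; rewrite ?(tc _).1 //; try exact: (tc _).1.
  move=> [s /= cs tij]; move/eqP: ij; apply; apply: tO.
  by rewrite -tij color_orbit_col_perm.
have [ci /eqP di] := tc i; apply/eqP => Si0; apply: di.
by rewrite -norm // Si0 mulr0.
Qed.
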